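(* The class $3\mathrm{LP}$ of connected unrooted $3$-leaf power graphs is specified (for all sizes $n\ge 3$, both in the labeled and in the unlabeled setting) by \begin{align*} 3\mathrm{LP} &= \mathcal{K}+\mathcal{T}_{S}+\mathcal{T}_{S-S}-\mathcal{T}_{S\to S}\\ \mathcal{T}_{S} &= \mathcal{L}\times\mathcal{S}_C\\ \mathcal{T}_{S-S} &= \mathrm{Set}_{2}(\mathcal{S}_X)\\ \mathcal{T}_{S\to S} &= \mathcal{S}_X\times\mathcal{S}_X\\ \mathcal{S}_C &= \mathrm{Set}_{\ge 2}(\mathcal{L}+\mathcal{S}_X)\\ \mathcal{S}_X &= \mathcal{L}\times \mathrm{Set}_{\ge 1}(\mathcal{L}+\mathcal{S}_X)\\ \mathcal{L} &= \mathcal{Z}+\mathrm{Set}_{\ge 2}(\mathcal{Z})\\ \mathcal{K} &= \mathrm{Set}_{\ge 3}(\mathcal{Z}). \end{align*}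
   Context: All graphs are finite and simple. A graph $G=(V,E)$ is a $3$-leaf power graph if there is a tree $T$ whose set of leaves is $V$ such that, for distinct $x,y\in V$, one has $xy\in E$ iff the distance in $T$ between the leaves $x$ and $y$ is at most $3$. The size of a graph is its number of vertices. In the unlabeled setting graphs are counted up to isomorphism; in the labeled setting the vertices are identified with $\{1,\dots,n\}$. Combinatorial classes are in the sense of Flajolet and Sedgewick: $\mathcal{Z}$ is the class with a single object (an atom), of size $1$; $+$ is disjoint union; $\times$ is Cartesian (labeled: labeled) product; $\mathrm{Set}_{\ge k}(\mathcal{A})$ (resp. $\mathrm{Set}_{k}(\mathcal{A})$) is the class of sets (in the unlabeled setting: multisets) of at least (resp. exactly) $k$ objects of $\mathcal{A}$. In the labeled setting, with exponential generating functions, $\mathrm{Set}_{k}(\mathcal A)$ has generating function $A(z)^k/k!$; in the unlabeled setting, with ordinary generating functions, the class $\mathrm{Set}(\mathcal A)$ of all multisets has generating function $\exp\big(\sum_{i\ge1}A(z^i)/i\big)$, and $\mathrm{Set}_{\ge k}$, $\mathrm{Set}_k$ are the restrictions to multisets with at least, resp. exactly, $k$ elements. ''The class is specified by the system'' means: the system determines (uniquely, by recursion on size) auxiliary classes without objects of size $0$, and the number of graphs of size $n$ in the class equals the number given by the first equation, the subtraction being understood at the level of the numbers of objects of each size (equivalently, $3\mathrm{LP}+\mathcal{T}_{S\to S}$ and $\mathcal{K}+\mathcal{T}_S+\mathcal{T}_{S-S}$ have the same number of objects of each size), in the labeled as well as in the unlabeled setting. By convention graphs of sizes $1$ and $2$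 are excluded from this comparison. *)

(* Defs.v *)
(* boolp is used only to turn "there is a tree such that ..."
   into a boolean, so that the graphs satisfying it form a finite type. *)
From HB Require Import structures.
From mathcomp Require Import all_boot all_fingroup.
From mathcomp Require Import boolp.

Set Implicit Arguments.
Unset Strict Implicit.
Unset Printing Implicit Defensive.

Record sgraph (V : finType) := SGraph {
  edges : {set {set V}};
  edges_pairs : [forall e in edges, #|e| == 2] }.

HB.instance Definition _ (V : finType) := [isSub for @edges V].
HB.instance Definition _ (V : finType) := [Finite of sgraph V by <:].

Section Graph.
Variables (V : finType) (G : sgraph V).

Definition adj : rel V := fun x y => [set x; y] \in edges G.

Definition degree (x : V) : nat := #|[set y | adj x y]|.

Definition connected : bool := (0 < #|V|) && [forall x, forall y, connect adj x y].

(* [ucycle adj c] also holds for the empty sequence and for the two endpoints of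
   an edge; the cycles of the graph are the [c] with at least three items. *)
Definition acyclic : Prop := forall c : seq V, ucycle adj c -> size c <= 2.

Definition is_tree : Prop := connected /\ acyclic.

(* The least length of a walk from [x] to [y]; it equals #|V| when there is no
   such walk. *)
Definition dist (x y : V) : nat :=
  find (fun k => [exists p : k.-tuple V, path adj x p && (last x p == y)])
       (iota 0 #|V|).

End Graph.

(* [leaf] identifies [V] with the set of leaves of [T]. *)
Definition is_leaf_root (k : nat) (V : finType) (G : sgraph V)
    (N : finType) (T : sgraph N) (leaf : V -> N) : Prop :=
  [/\ is_tree T,
      injective leaf,
      forall t : N, (exists x, leaf x = t) <-> degree T t = 1
    & forall x y : V, x != y ->
        (adj G x y <-> dist T (leaf x) (leaf y) <= k)].

Definition leaf_power (k : nat) (V : finType) (G : sgraph V) : Prop :=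
  exists (N : finType) (T : sgraph N) (leaf : V -> N), is_leaf_root k G T leaf.

Definition isomorphic (V : finType) (G H : sgraph V) : bool :=
  [exists s : {perm V}, [forall x, forall y, adj G x y == adj H (s x) (s y)]].

(* [A n] is the finite type of the objects of size [n].  In the labeled setting
   these are the well-labeled objects, with labels in ['I_n]. *)
Definition cclass := nat -> finType.

(* Existence of a size-preserving bijection. *)
Definition ciso (A B : cclass) : Prop :=
  forall n, exists f : A n -> B n, bijective f.

Definition no_size0 (A : cclass) : Prop := #|A 0| = 0.

Inductive setting := Labeled | Unlabeled.

Definition catom : cclass := fun n => 'I_(n == 1).

Definition csum (A B : cclass) : cclass := fun n => (A n + B n)%type.

Definition uprod (A B : cclass) : cclass :=
  fun n => {i : 'I_n.+1 & (A i * B (n - i))%type}.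

(* The first factor receives the labels in [X], the second one the others;
   relabelings are order preserving, so an object whose label set is [X] is just
   an object of size #|X|. *)
Definition lprod (A B : cclass) : cclass :=
  fun n => {X : {set 'I_n} & (A #|X| * B #|~: X|)%type}.

Definition cprod (s : setting) : cclass -> cclass -> cclass :=
  if s is Labeled then lprod else uprod.

(* [uset C A]: multisets of objects of [A] whose number of elements (counted
   with multiplicity) satisfies [C].  A multiset is given by its multiplicity
   function; when [A] has no object of size 0, an object occurring in a multiset
   of size [n] has size at most [n] and multiplicity at most [n]. *)
Definition uset (C : pred nat) (A : cclass) : cclass :=
  fun n => {m : {ffun {i : 'I_n.+1 & A i} -> 'I_n.+1}
           | (\sum_x m x * tag x == n) && C (\sum_x m x)}.

(* [lset C A]: sets of objects of [A] whose number of elements satisfies [C].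
   The label sets of the elements partition the labels, and, [A] having no
   object of size 0, every element has a nonempty label set. *)
Definition lset (C : pred nat) (A : cclass) : cclass :=
  fun n => {P : {P : {set {set 'I_n}} | partition P [set: 'I_n] && C #|P|}
           & {dffun forall B : {B : {set 'I_n} | B \in val P}, A #|val B|}}.

Definition cset (s : setting) : pred nat -> cclass -> cclass :=
  if s is Labeled then lset else uset.

Definition cset_ge (s : setting) (k : nat) : cclass -> cclass :=
  cset s (fun j => k <= j).

Definition cset_eq (s : setting) (k : nat) : cclass -> cclass :=
  cset s (fun j => j == k).

Definition is_3LP (V : finType) (G : sgraph V) : bool :=
  connected G && `[< leaf_power 3 G >].

Definition labeled_3LP : cclass := fun n => {G : sgraph 'I_n | is_3LP G}.

Definition unlabeled_3LP : cclass :=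
  fun n => {I : {set sgraph 'I_n}
           | I \in equivalence_partition (@isomorphic 'I_n)
                     [set G : sgraph 'I_n | is_3LP G]}.

Definition class_3LP (s : setting) : cclass :=
  if s is Labeled then labeled_3LP else unlabeled_3LP.

Record system_classes := SystemClasses {
  cT_S : cclass;
  cT_SS : cclass;     (* T_{S-S} *)
  cT_StoS : cclass;   (* T_{S->S} *)
  cS_C : cclass;
  cS_X : cclass;
  cL : cclass;
  cK : cclass }.

Definition classes_no_size0 (X : system_classes) : Prop :=
  [/\ no_size0 (cT_S X), no_size0 (cT_SS X) & no_size0 (cT_StoS X)] /\
  [/\ no_size0 (cS_C X), no_size0 (cS_X X), no_size0 (cL X) & no_size0 (cK X)].

Definition satisfies_equations (s : setting) (X : system_classes) : Prop :=
  [/\ ciso (cT_S X) (cprod s (cL X) (cS_C X)),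
      ciso (cT_SS X) (cset_eq s 2 (cS_X X))
    & ciso (cT_StoS X) (cprod s (cS_X X) (cS_X X))] /\
  [/\ ciso (cS_C X) (cset_ge s 2 (csum (cL X) (cS_X X))),
      ciso (cS_X X) (cprod s (cL X) (cset_ge s 1 (csum (cL X) (cS_X X)))),
      ciso (cL X) (csum catom (cset_ge s 2 catom))
    & ciso (cK X) (cset_ge s 3 catom)].

Definition solution (s : setting) (X : system_classes) : Prop :=
  classes_no_size0 X /\ satisfies_equations s X.

Definition classes_iso (X Y : system_classes) : Prop :=
  [/\ ciso (cT_S X) (cT_S Y), ciso (cT_SS X) (cT_SS Y)
    & ciso (cT_StoS X) (cT_StoS Y)] /\
  [/\ ciso (cS_C X) (cS_C Y), ciso (cS_X X) (cS_X Y),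
      ciso (cL X) (cL Y) & ciso (cK X) (cK Y)].

(* Main.v *)
(* A connected 3-leaf power on at least three vertices is obtained from a tree by
   replacing its nodes with cliques; the tree has one node or at least three, and
   it is then determined by the graph (its nodes are the classes of true twins).
   Both settings are treated at once as counting trees whose nodes carry nonzero
   weights in nat^W with a given total weight: W is the set of labels and the
   total is 1 at each label, or W is a singleton and the total is n.  Rooted at an
   internal node, such trees up to isomorphism are the objects of T_S; a pair of
   trees [a, b] of S_X is an internal edge with a direction.  Order S_X by size,
   then arbitrarily.  Sending [a > b] to the tree rooted at the root of [b] is
   injective, its image consists of the trees having a child larger than
   everything else, and pushing the root towards that child reaches, whatever the
   internal node one starts from, the same rooted tree.  Hence T_S counts the
   unrooted trees with at least three nodes plus the pairs [a > b], and there are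
   as many such pairs as objects of T_{S->S} minus objects of T_{S-S}. *)
From HB Require Import structures.
From mathcomp Require Import all_boot all_fingroup ssralg.
From mathcomp Require Import boolp.
Require Import Defs.

Set Implicit Arguments.
Unset Strict Implicit.
Unset Printing Implicit Defensive.

Import GRing.Theory.

(** A solution of the system is known only through the cardinalities of its classes. Each class is
    therefore replaced, size by size, by a predicate on concrete lists and trees that it [encodes],
    and equalities of numbers become equivalences of predicates. The predicates prescribe a weight:
    splitting it covers both the choice of label sets and the addition of sizes, so that no
    relabeling ever acts on objects. Lists and kids are kept sorted, which makes equality of codes
    the isomorphism of rooted weighted trees. The remaining difficulty is the root: a graph
    determines its tree only up to rerooting. The center serves twice, to pick one root per unrooted
    tree in the count and to make the code a complete invariant of a graph. Trees with two nodes
    must be kept out, since two completely joined cliques form one clique; together with the wish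
    for an internal root this is why [size (kids t) != 1] recurs. *)

Lemma sum_map_rem (T : eqType) (R : nmodType) (F : T -> R) (x : T) (s : seq T) :
  x \in s -> (\sum_(y <- s) F y = F x + \sum_(y <- rem x s) F y)%R.
Proof. by move=> xs; rewrite (perm_big _ (perm_to_rem xs)) big_cons. Qed.

Lemma uniq_map_inj (T U : eqType) (f : T -> U) (s : seq T) :
  uniq (map f s) -> {in s &, injective f}.
Proof.
move=> uf x y xs ys eqf.
have lx : index x s < size s by rewrite index_mem.
have ly : index y s < size s by rewrite index_mem.
have : nth (f x) (map f s) (index x s) = nth (f x) (map f s) (index y s).
  by rewrite !(nth_map x) // !nth_index.
move/eqP; rewrite nth_uniq ?size_map // => /eqP ixy.
by rewrite -(nth_index x xs) ixy nth_index.
Qed.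

(** * Encodings of finite types *)

(** [F] enumerates [P] without repetition. Only the cardinality of [F] matters ([encodes_eqcard]),
    so a class given up to [ciso] can be modelled by any convenient objects. *)
Definition encodes (F : finType) (T : eqType) (P : T -> Prop) :=
  exists2 f : F -> T, injective f & forall x, P x <-> exists i, f i = x.

Lemma encodes_ext (F : finType) (T : eqType) (P Q : T -> Prop) :
  (forall x, P x <-> Q x) -> encodes F P -> encodes F Q.
Proof. by move=> PQ [f fI fP]; exists f => // x; rewrite -PQ. Qed.

Lemma encodes_leq (F G : finType) (T : eqType) (P : T -> Prop) :
  encodes F P -> encodes G P -> #|F| <= #|G|.
Proof.
move=> [f fI fP] [g gI gP].
have h i : exists j, g j = f i by apply/gP/fP; exists i.
have [k kP] := choice h.
suff kI : injective k by apply: leq_card kI.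
by move=> i j eqk; apply: fI; rewrite -!kP eqk.
Qed.

Lemma encodes_card (F G : finType) (T : eqType) (P : T -> Prop) :
  encodes F P -> encodes G P -> #|F| = #|G|.
Proof. by move=> FP GP; apply/eqP; rewrite eqn_leq !(encodes_leq (P := P)). Qed.

Lemma card_bij (F G : finType) : #|F| = #|G| -> exists f : F -> G, bijective f.
Proof.
move=> eqc; exists (fun x => enum_val (cast_ord eqc (enum_rank x))).
exists (fun y => enum_val (cast_ord (esym eqc) (enum_rank y))) => x.
  by rewrite enum_valK cast_ordK enum_rankK.
by rewrite enum_valK cast_ordKV enum_rankK.
Qed.

Lemma encodes_eqcard (F G : finType) (T : eqType) (P : T -> Prop) :
  #|F| = #|G| -> encodes F P -> encodes G P.
Proof.
move=> /esym/card_bij [h [k hK kK]] [f fI fP].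
exists (f \o h) => [|x]; first exact: inj_comp (can_inj hK).
rewrite fP; split=> [[i <-]|[j <-]]; last by exists (h j).
by exists (k i); rewrite /= kK.
Qed.

Lemma encodes_map (F : finType) (T U : eqType) (P : T -> Prop) (Q : U -> Prop)
    (h : T -> U) :
  (forall x y, P x -> P y -> h x = h y -> x = y) ->
  (forall y, Q y <-> exists2 x, P x & h x = y) ->
  encodes F P -> encodes F Q.
Proof.
move=> hI hQ [f fI fP]; exists (h \o f) => [i j /= /hI eqf|y].
  by apply: fI; apply: eqf; apply/fP; [exists i | exists j].
rewrite hQ; split=> [[x /fP [i <-] <-]|[i <-]]; first by exists i.
by exists (f i) => //; apply/fP; exists i.
Qed.

Lemma encodes_sum (F G : finType) (T : eqType) (P Q : T -> Prop) :
  (forall x, P x -> ~ Q x) -> encodes F P -> encodes G Q ->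
  encodes (F + G)%type (fun x => P x \/ Q x).
Proof.
move=> PQ [f fI fP] [g gI gP].
exists (fun i : F + G => match i with inl i => f i | inr j => g j end).
  move=> [i|i] [j|j] eqf; first by rewrite (fI _ _ eqf).
  - by case: (PQ (f i)); [apply/fP; exists i | apply/gP; exists j].
  - by case: (PQ (f j)); [apply/fP; exists j | apply/gP; exists i].
  - by rewrite (gI _ _ eqf).
move=> x; rewrite fP gP; split.
  by case=> [[i <-]|[i <-]]; [exists (inl i) | exists (inr i)].
by case=> [[i|i] <-]; [left | right]; exists i.
Qed.

Lemma encodes_pred (T : finType) (P : pred T) : encodes {x | P x} (fun x => P x).
Proof.
exists val => [|x]; first exact: val_inj.
by split=> [Px|[[y Py] <-] //]; exists (exist _ x Px).
Qed.

Lemma encodes_ord (n : nat) : encodes 'I_n (fun j : nat => j < n).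
Proof.
exists val => [|j]; first exact: val_inj.
by split=> [jn|[i <-]]; [exists (Ordinal jn) | exact: ltn_ord].
Qed.

Lemma encodes0 (F : finType) (T : eqType) (P : T -> Prop) :
  #|F| = 0 -> (forall x, ~ P x) -> encodes F P.
Proof.
move=> F0 P0; have F0' (i : F) : False by have := max_card (pred1 i); rewrite F0 card1.
by exists (fun i => match F0' i with end) => [i|x]; [case: (F0' i)|split=> [/P0|[i]] //; case: (F0' i)].
Qed.

Lemma encodes1 (F : finType) (T : eqType) (x : T) :
  #|F| = 1 -> encodes F (fun y => y = x).
Proof.
move=> F1; apply: (encodes_eqcard (F := unit)); first by rewrite F1 card_unit.
by exists (fun=> x) => [[] []|y] //; split=> [->|[]//]; exists tt.
Qed.

(** * Rose trees *)

Inductive rtree (T : Type) := Node of T & seq (rtree T).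

Section RtreeType.
Variable T : Type.
Implicit Types (t c : rtree T).

Definition root t := let: Node a _ := t in a.
Definition kids t := let: Node _ s := t in s.

Fixpoint nodes t : seq T := let: Node a s := t in a :: flatten (map nodes s).

Fixpoint Forall_t (P : rtree T -> Prop) s : Prop :=
  if s is c :: s' then P c /\ Forall_t P s' else True.

Definition rtree_ind_Forall (P : rtree T -> Prop)
    (H : forall a s, Forall_t P s -> P (Node a s)) : forall t, P t :=
  fix F t : P t := let: Node a s := t in
    H a s ((fix G s : Forall_t P s := if s is c :: s' then conj (F c) (G s') else I) s).

Fixpoint enc_rtree t : GenTree.tree T :=
  let: Node a s := t in GenTree.Node 0 (GenTree.Leaf a :: map enc_rtree s).

Fixpoint dec_rtree (g : GenTree.tree T) : option (rtree T) :=
  if g is GenTree.Node _ (GenTree.Leaf a :: s) then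
    Some (Node a (pmap dec_rtree s)) else None.

Lemma enc_rtreeK : pcancel enc_rtree dec_rtree.
Proof.
elim/rtree_ind_Forall => a s IH /=; congr (Some (Node a _)).
by elim: s IH => //= c s IHs [-> /IHs ->].
Qed.

End RtreeType.

HB.instance Definition _ (T : eqType) := Equality.copy (rtree T) (pcan_type (@enc_rtreeK T)).
HB.instance Definition _ (T : choiceType) := Choice.copy (rtree T) (pcan_type (@enc_rtreeK T)).
HB.instance Definition _ (T : countType) := Countable.copy (rtree T) (pcan_type (@enc_rtreeK T)).

Lemma rtree_ind' (T : eqType) (P : rtree T -> Prop) :
  (forall a s, {in s, forall c, P c} -> P (Node a s)) -> forall t, P t.
Proof.
move=> H; elim/rtree_ind_Forall => a s IH; apply: H.
elim: s IH => //= c s IHs [Pc /IHs Ps] d; rewrite inE => /predU1P[-> //|]; exact: Ps.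
Qed.

Fixpoint rmap (T U : Type) (f : T -> U) (t : rtree T) : rtree U :=
  let: Node a s := t in Node (f a) (map (rmap f) s).

Lemma rmap_comp (T : eqType) (U V : Type) (g : U -> V) (f : T -> U) (t : rtree T) :
  rmap g (rmap f t) = rmap (g \o f) t.
Proof.
elim/rtree_ind': t => a s IH /=; congr Node; rewrite -map_comp.
exact/eq_in_map.
Qed.

Lemma nodes_rmap (T : eqType) (U : Type) (f : T -> U) (t : rtree T) :
  nodes (rmap f t) = map f (nodes t).
Proof.
elim/rtree_ind': t => a s IH /=; congr cons.
rewrite map_flatten -!map_comp; congr flatten; exact/eq_in_map.
Qed.

Lemma mem_nodes_kid (T : eqType) (a : T) s c x :
  c \in s -> x \in nodes c -> x \in nodes (Node a s).
Proof.
move=> cs xc /=; rewrite inE; apply/orP; right.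
by apply/flattenP; exists (nodes c) => //; apply: map_f.
Qed.

Lemma nodes_kidP (T : eqType) (a : T) s x :
  reflect (x = a \/ exists2 c, c \in s & x \in nodes c) (x \in nodes (Node a s)).
Proof.
rewrite /= inE; apply: (iffP orP).
  case=> [/eqP -> |/flattenP[_ /mapP[c cs ->] xc]]; [by left|right; by exists c].
case=> [->|[c cs xc]]; [by left; rewrite eqxx|right].
by apply/flattenP; exists (nodes c) => //; apply: map_f.
Qed.

Lemma root_nodes (T : eqType) (t : rtree T) : root t \in nodes t.
Proof. by case: t => a s /=; rewrite mem_head. Qed.

Lemma encodes_tag (I : finType) (F : I -> finType) (T : eqType)
    (R : I -> T -> Prop) :
  (forall i j x, R i x -> R j x -> i = j) ->
  (forall i, encodes (F i) (R i)) ->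
  encodes {i : I & F i} (fun x => exists i, R i x).
Proof.
move=> Rd enc.
pose f i := s2val (cid2 (enc i)).
have fI i : injective (f i) by rewrite /f; case: cid2.
have fP i x : R i x <-> exists j, f i j = x by rewrite /f; case: cid2.
exists (fun z : {i : I & F i} => f (tag z) (tagged z)).
  move=> [i x] [j y] /= eqf.
  have eij : i = j by apply: (Rd i j (f i x)); apply/fP; [exists x | rewrite eqf; exists y].
  by case: j / eij y eqf => y /fI ->.
move=> x; split=> [[i /fP [j <-]]|[[i j] <-]]; first by exists (existT (fun i => F i : Type) i j).
by exists i; apply/fP; exists j.
Qed.

(** The second factor has to be encoded only if the first is inhabited. This makes recursion through
    a product well founded: when [A] has no object of size 0, the second factor never has the full
    size. *)
Lemma encodes_pair (F G : finType) (T U : eqType) (P : T -> Prop) (Q : U -> Prop) :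
  encodes F P -> (0 < #|F| -> encodes G Q) ->
  encodes (F * G)%type (fun z : T * U => P z.1 /\ Q z.2).
Proof.
move=> FP GQ; have [F0|F_gt0] := posnP #|F|.
  apply: encodes0 => [|[x y] [/= Px _]]; first by rewrite card_prod F0.
  by case: FP => f _ /(_ x) [/(_ Px) [i _] _]; have := max_card (pred1 i); rewrite F0 card1.
case: FP (GQ F_gt0) => f fI fP [g gI gP].
exists (fun z => (f z.1, g z.2)) => [[i j] [i' j'] [/fI -> /gI ->] //|[x y] /=].
rewrite fP gP; split=> [[[i <-] [j <-]]|[[i j] [<- <-]]]; first by exists (i, j).
by split; [exists i | exists j].
Qed.

(** * Weights *)

Section Weight.
Variable W : finType.
Implicit Types (m p : {ffun W -> nat}).

Definition msz m := \sum_w m w.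
Definition delta (w : W) : {ffun W -> nat} := [ffun x => (x == w) : nat].

Lemma wD m p w : (m + p)%R w = m w + p w.
Proof. by rewrite ffunE. Qed.

Lemma w0 w : (0%R : {ffun W -> nat}) w = 0.
Proof. by rewrite ffunE. Qed.

Lemma w_sum (I : Type) (r : seq I) (P : pred I) (F : I -> {ffun W -> nat}) w :
  (\sum_(i <- r | P i) F i)%R w = \sum_(i <- r | P i) F i w.
Proof. by elim/big_rec2: _ => [|i x y _ <-]; rewrite ?w0 ?wD. Qed.

Lemma mszD m p : msz (m + p)%R = msz m + msz p.
Proof. by rewrite /msz -big_split; apply: eq_bigr => w _; rewrite wD. Qed.

Lemma msz0 : msz 0%R = 0.
Proof. by rewrite /msz big1 // => w _; rewrite w0. Qed.

Lemma msz_sum (I : Type) (r : seq I) (P : pred I) (F : I -> {ffun W -> nat}) :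
  msz (\sum_(i <- r | P i) F i)%R = \sum_(i <- r | P i) msz (F i).
Proof. by elim/big_rec2: _ => [|i x y _ <-]; rewrite ?msz0 ?mszD. Qed.

Lemma msz_delta w : msz (delta w) = 1.
Proof.
rewrite /msz (bigD1 w) //= ffunE eqxx big1 // => x /negPf xw.
by rewrite ffunE xw.
Qed.

Lemma msz_eq0 m : (msz m == 0) = (m == 0%R).
Proof.
apply/eqP/eqP => [m0|->]; last exact: msz0.
apply/ffunP => w; rewrite w0; apply/eqP.
by have /eqP := m0; rewrite sum_nat_eq0 => /forallP /(_ w).
Qed.

Lemma msz_gt0 m : (0 < msz m) = (m != 0%R).
Proof. by rewrite lt0n msz_eq0. Qed.

Lemma wIr m p q : (m + p = m + q)%R -> p = q.
Proof.
move=> /ffunP e; apply/ffunP => w; apply/eqP.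
by have := e w; rewrite !wD => /eqP; rewrite eqn_add2l.
Qed.

(** The bound [<= 1], instead of an equality, is inherited by both parts of a split weight. In the
    unlabeled case a weight on a one-point [W] is just a number. *)
Definition adm (s : setting) m : Prop :=
  if s is Labeled then forall w, m w <= 1 else #|W| = 1.

Lemma admDl s m p : adm s (m + p)%R -> adm s m.
Proof. by case: s => // H w; apply: leq_trans (H w); rewrite wD leq_addr. Qed.

Lemma admDr s m p : adm s (m + p)%R -> adm s p.
Proof. by rewrite addrC; apply: admDl. Qed.

Lemma unlabeled_mszI m p : #|W| = 1 -> msz m = msz p -> m = p.
Proof.
move=> W1; have [w wP] : exists w : W, forall x, x = w.
  by have /eqP/fintype1P [w wP] := W1; exists w.
have E q : msz q = q w.
  by rewrite /msz (bigD1 w) //= big1 ?addn0 // => x; rewrite (wP x) eqxx.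
by rewrite !E => e; apply/ffunP => x; rewrite (wP x).
Qed.

Lemma mszi i : #|W| = 1 -> exists nu : {ffun W -> nat}, msz nu = i.
Proof.
move=> /eqP/fintype1P [w wP].
exists [ffun=> i]; rewrite /msz (bigD1 w) //= big1 ?addn0 ?ffunE // => x.
by rewrite (wP x) eqxx.
Qed.

(** [lprod] and [lset] speak of subsets of ['I_n], weights live on [W]: [e] numbers the support of a
    0/1 weight, so that its parts become subsets of ['I_n]. *)
Lemma labeled_support m n : (forall w, m w <= 1) -> msz m = n ->
  exists2 e : 'I_n -> W, injective e & m = (\sum_i delta (e i))%R.
Proof.
move=> m1 mn; pose A := [set w | m w == 1].
have mA w : m w = (w \in A) by rewrite inE; case: (m w) (m1 w) => [|[]].
have An : #|A| = n.
  rewrite -mn /msz -sum1_card big_mkcond; apply: eq_bigr => w _.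
  by rewrite mA; case: ifP.
case: n / An mn => _.
exists (fun i => enum_val i) => [i j /enum_val_inj //|].
rewrite -(@big_enum_val _ _ _ _ (mem A) delta).
apply/ffunP => w; rewrite w_sum mA; have [wA|wA] := boolP (w \in A).
  rewrite (bigD1 w) //= ffunE eqxx big1 // => x /andP[_ /negPf xw].
  by rewrite ffunE eq_sym xw.
by rewrite big1 // => x xA; rewrite ffunE; case: eqP => // wx; rewrite wx xA in wA.
Qed.

End Weight.

Section LabelSubset.
Variables (W : finType) (n : nat) (e : 'I_n -> W).
Hypothesis eI : injective e.

Definition subw (Y : {set 'I_n}) : {ffun W -> nat} := (\sum_(i in Y) delta (e i))%R.

Lemma msz_subw Y : msz (subw Y) = #|Y|.
Proof. by rewrite msz_sum -sum1_card; apply: eq_bigr => i _; rewrite msz_delta. Qed.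

Lemma subwE Y i : subw Y (e i) = (i \in Y).
Proof.
rewrite w_sum; have [iY|iY] := boolP (i \in Y).
  rewrite (bigD1 i) //= ffunE eqxx big1 // => j /andP[_ ji].
  by rewrite ffunE (inj_eq eI) eq_sym (negPf ji).
rewrite big1 // => j jY; rewrite ffunE (inj_eq eI); case: eqP => // ij.
by rewrite ij jY in iY.
Qed.

Lemma subwI : injective subw.
Proof.
move=> Y Z eYZ; apply/setP => i; apply: (can_inj oddb).
by rewrite -!subwE eYZ.
Qed.

Lemma subwC Y : (subw Y + subw (~: Y))%R = subw setT.
Proof.
rewrite /subw [in RHS](bigID (mem Y)) /=; congr (_ + _)%R.
  by apply: eq_bigl => i; rewrite inE.
by apply: eq_bigl => i; rewrite !inE.
Qed.

Lemma subw_le m p : (m + p)%R = subw setT -> exists Y, m = subw Y.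
Proof.
move=> mp; exists [set i | m (e i) == 1]; apply/ffunP => w.
have mle : m w <= subw setT w by rewrite -mp wD leq_addr.
have [[i <-]|no] := EM (exists i, e i = w).
  rewrite subwE inE; have := subwE setT i; rewrite inE -mp wD.
  by case: (m (e i)) => [|[]].
have z Y : subw Y w = 0.
  rewrite w_sum big1 // => i _; rewrite ffunE; case: eqP => // wi.
  by case: no; exists i.
by rewrite z; apply/eqP; rewrite -leqn0 -(z setT).
Qed.

End LabelSubset.

(** A splitting of [mu] into two weights is a set of labels (through [subw]) in the labeled setting
    and a size [i] in the unlabeled one, which is exactly the index of the dependent sum defining
    the product. *)
Lemma encodes_cprod (s : setting) (A B : cclass) (W : finType) (T U : eqType)
    (P : T -> Prop) (Q : U -> Prop) (t : T -> {ffun W -> nat}) (u : U -> {ffun W -> nat})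
    (mu : {ffun W -> nat}) (n : nat) :
  adm s mu -> msz mu = n ->
  (forall nu rho, (nu + rho)%R = mu -> encodes (A (msz nu)) (fun x => P x /\ t x = nu)) ->
  (forall nu rho, (nu + rho)%R = mu -> 0 < #|A (msz nu)| ->
     encodes (B (msz rho)) (fun x => Q x /\ u x = rho)) ->
  encodes (cprod s A B n)
    (fun z : T * U => [/\ P z.1, Q z.2 & (t z.1 + u z.2)%R = mu]).
Proof.
move=> admu mun HA HB.
have key (nu rho : {ffun W -> nat}) : (nu + rho)%R = mu ->
  encodes (A (msz nu) * B (msz rho))%type
     (fun z : T * U => (P z.1 /\ t z.1 = nu) /\ (Q z.2 /\ u z.2 = rho)).
  by move=> numu; exact: (encodes_pair (HA _ _ numu) (HB _ _ numu)).
case: s admu => [m1|W1] /=.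
  have [e eI mue] := labeled_support m1 mun.
  have {}mue : mu = subw e setT by rewrite mue /subw; apply: eq_bigl => i; rewrite inE.
  pose R (Y : {set 'I_n}) (z : T * U) :=
    (P z.1 /\ t z.1 = subw e Y) /\ (Q z.2 /\ u z.2 = subw e (~: Y)).
  apply: (@encodes_ext _ _ (fun z => exists Y, R Y z)) => [[x y]|].
    split=> /= [[Y [/= [Px tx] [Qy uy]]]|[/= Px Qy tu]].
      by split=> //=; rewrite tx uy subwC mue.
    have [Y tY] := subw_le eI (etrans tu mue).
    exists Y; do 2!split=> //=; apply: (wIr (m := t x)).
    by rewrite tu mue -(subwC e Y) tY.
  apply: encodes_tag => [Y Z [x y] [[_ /= tY] _] [[_ /= tZ] _]|Y].
    by apply: (subwI eI); rewrite -tY -tZ.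
  by have /key := etrans (subwC e Y) (esym mue); rewrite !msz_subw.
pose R (i : 'I_n.+1) (z : T * U) :=
    (P z.1 /\ msz (t z.1) = i) /\ (Q z.2 /\ msz (u z.2) = n - i).
apply: (@encodes_ext _ _ (fun z => exists Y, R Y z)) => [[x y]|].
  split=> /= [[i [/= [Px tx] [Qy uy]]]|[/= Px Qy tu]].
    by split=> //=; apply: unlabeled_mszI => //; rewrite mszD tx uy mun subnKC // -ltnS.
  have le_n : msz (t x) < n.+1 by rewrite ltnS -mun -tu mszD leq_addr.
  exists (Ordinal le_n); do 2!split=> //=.
  by rewrite -mun -tu mszD addKn.
apply: encodes_tag => [i j [x y] [[_ /= ti] _] [[_ /= tj]] _|i].
  by apply: val_inj; rewrite /= -ti -tj.
have [nu nui] := mszi i W1; have [rho rhoi] := mszi (n - i) W1.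
have /key : (nu + rho)%R = mu.
  by apply: unlabeled_mszI => //; rewrite mszD nui rhoi mun subnKC // -ltnS.
rewrite nui rhoi; apply: encodes_ext => -[x y] /=; rewrite /R /= -rhoi -nui.
by split=> -[[Px tx] [Qy uy]]; do 2!split=> //; rewrite ?tx ?uy //; apply: unlabeled_mszI.
Qed.

(** One identity for all statistics of the list that realizes a multiplicity function: its total
    size, its length and its multiplicities are the cases where [F] is the size, 1 or an
    indicator. *)
Lemma sum_of_uset (I : finType) (T : eqType) (ord : rel T) (g : I -> T)
    (m : I -> nat) (F : T -> nat) :
  \sum_(x <- sort ord (flatten [seq nseq (m z) (g z) | z <- enum I])) F x =
  \sum_z m z * F (g z).
Proof.
rewrite (perm_big _ (permEl (perm_sort _ _))) big_flatten big_map big_enum.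
by apply: eq_bigr => z _; rewrite big_nseq iter_addn_0 mulnC.
Qed.

Lemma count_sum (T : Type) (a : pred T) (s : seq T) : count a s = \sum_(x <- s) a x.
Proof. by elim: s => [|x s IH] /=; rewrite ?big_nil ?big_cons ?IH. Qed.

(** A multiset is represented by its sorted listing, which is unique because [ord] is a total
    order. *)
Lemma encodes_uset (C : pred nat) (A : cclass) (T : eqType) (ord : rel T)
    (P : T -> Prop) (sz : T -> nat) (n : nat) :
  total ord -> transitive ord -> antisymmetric ord ->
  (forall x, P x -> 0 < sz x) ->
  (forall i, i <= n -> encodes (A i) (fun x => P x /\ sz x = i)) ->
  encodes (uset C A n) (fun l : seq T =>
    [/\ sorted ord l, {in l, forall x, P x}, \sum_(x <- l) sz x = n & C (size l)]).
Proof.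
move=> ordT ordTr ordA sz_gt0 HA.
have enc (i : 'I_n.+1) := HA i (ltn_ord i : i <= n).
pose f i := s2val (cid2 (enc i)).
have fI i : injective (f i) by rewrite /f; case: cid2.
have fP (i : 'I_n.+1) x : P x /\ sz x = i <-> exists j, f i j = x by rewrite /f; case: cid2.
have fPs (i : 'I_n.+1) j : P (f i j) /\ sz (f i j) = i by apply/fP; exists j.
pose J : finType := {i : 'I_n.+1 & A i}.
pose g (z : J) := f (tag z) (tagged z).
have gI : injective g.
  move=> [i x] [j y]; rewrite /g /= => eqf.
  have eij : i = j by apply: val_inj; rewrite /= -(proj2 (fPs i x)) eqf (proj2 (fPs j y)).
  by case: j / eij y eqf => y /fI ->.
have gsz z : sz (g z) = tag z by rewrite (proj2 (fPs _ _)).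
have gP x : P x -> sz x <= n -> exists z, g z = x.
  rewrite -ltnS => Px le_n; have /fP [a <-] : P x /\ sz x = Ordinal le_n by [].
  by exists (existT (fun i : 'I_n.+1 => A i : Type) (Ordinal le_n) a).
pose h (m : {ffun J -> 'I_n.+1}) := sort ord (flatten [seq nseq (m z) (g z) | z <- enum J]).
have hsz m : \sum_(x <- h m) sz x = \sum_z m z * tag z.
  by rewrite sum_of_uset; apply: eq_bigr => z _; rewrite gsz.
have hsize m : size (h m) = \sum_z m z.
  by rewrite -sum1_size sum_of_uset; apply: eq_bigr => z _; rewrite muln1.
have hcount m z : count_mem (g z) (h m) = m z.
  rewrite count_sum sum_of_uset (bigD1 z) //= eqxx muln1 big1 ?addn0 // => y yz.
  by rewrite (inj_eq gI) (negPf yz) muln0.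
apply: encodes_map (encodes_pred _) => [m p _ _ hm|l].
  by apply/ffunP => z; apply: val_inj; rewrite /= -!hcount; congr count; exact: hm.
split=> [[ls lP lsz lC]|[m /andP[/eqP msz mC] <-]]; last first.
  split; [exact: sort_sorted | | by rewrite hsz | by rewrite hsize].
  by move=> x; rewrite mem_sort => /flattenP [_ /mapP[z _ ->] /nseqP[-> _]]; case: (fPs (tag z) (tagged z)).
(* Elements have positive size, so the length, and with it every multiplicity, is at most [n]: the
   [inord] below truncates nothing. *)
have size_le : size l <= n.
  rewrite -lsz -sum1_size big_seq [leqRHS]big_seq; apply: leq_sum => x /lP; exact: sz_gt0.
pose m : {ffun J -> 'I_n.+1} := [ffun z => inord (count_mem (g z) l)].
have mE z : m z = count_mem (g z) l :> nat.
  by rewrite ffunE inordK // ltnS (leq_trans (count_size _ _)).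
have hl : h m = l.
  apply: (sorted_eq ordTr ordA) => //; first exact: sort_sorted.
  apply/allP => x; rewrite mem_cat => /orP xh; apply/eqP.
  have [z <-] : exists z, g z = x.
    case: xh => [|xl].
      by rewrite mem_sort => /flattenP [_ /mapP[z _ ->] /nseqP[-> _]]; exists z.
    apply: gP; first exact: lP.
    by rewrite -lsz (sum_map_rem _ xl) leq_addr.
  by rewrite /= hcount mE.
by exists m => //; rewrite -hsz -hsize hl lsz eqxx.
Qed.

(** A nonempty set listed twice would cover its points twice. *)
Lemma uniq_cover1 (T : finType) (ys : seq {set T}) :
  {in ys, forall Y, Y != set0} -> (forall i, count (fun Y : {set T} => i \in Y) ys = 1) ->
  uniq ys /\ partition [set Y in ys] setT.
Proof.
move=> ne0 c1.
have ys_uniq : uniq ys.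
  have c1' i : count (fun Y : {set T} => i \in Y) ys <= 1 by rewrite c1.
  elim: ys ne0 c1' {c1} => //= Y ys IH ne0 c1; apply/andP; split; last first.
    apply: IH => [Z Zys|i]; first by apply: ne0; rewrite inE Zys orbT.
    exact: leq_trans (leq_addl _ _) (c1 i).
  have /set0Pn [i iY] := ne0 Y (mem_head _ _).
  apply/negP => Yys; have := c1 i; rewrite iY leqNgt ltnS -has_count.
  by case/negP; apply/hasP; exists Y.
split=> //; rewrite /partition; apply/and3P; split.
- apply/eqP/setP => i; rewrite [RHS]inE; apply/bigcupP.
  have /hasP [Y Yys iY] : has (fun Y : {set T} => i \in Y) ys by rewrite has_count c1.
  by exists Y; rewrite ?inE.
- apply/trivIsetP => Y Z; rewrite !inE => Yys Zys; apply: contraNT.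
  case/pred0Pn => i /andP[/= iY iZ].
  have := c1 i; rewrite -size_filter.
  have YF : Y \in [seq Y <- ys | i \in (Y : {set T})] by rewrite mem_filter iY.
  have ZF : Z \in [seq Y <- ys | i \in (Y : {set T})] by rewrite mem_filter iZ.
  by move: YF ZF; case: filter => [|X []] //; rewrite !inE => /eqP -> /eqP ->.
- by rewrite inE; apply/negP => /ne0; rewrite eqxx.
Qed.

(** An object shows its label set in its weight ([supp]). Since the weights add up to 1 on each
    label, the supports form a partition and no two elements of the list share a support; the list
    is thus a choice of one object on each block. *)
Lemma encodes_lset (C : pred nat) (A : cclass) (W : finType) (n : nat)
    (e : 'I_n -> W) (T : eqType) (ord : rel T) (P : T -> Prop)
    (t : T -> {ffun W -> nat}) :
  injective e -> total ord -> transitive ord -> antisymmetric ord ->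
  (forall x, P x -> t x != 0%R) ->
  (forall Y : {set 'I_n}, encodes (A #|Y|) (fun x => P x /\ t x = subw e Y)) ->
  encodes (lset C A n) (fun l : seq T =>
    [/\ sorted ord l, {in l, forall x, P x}, (\sum_(x <- l) t x)%R = subw e setT
      & C (size l)]).
Proof.
move=> eI ordT ordTr ordA t_neq0 enc.
pose supp x := [set i | t x (e i) == 1].
have suppE x Y : t x = subw e Y -> supp x = Y.
  by move=> tx; apply/setP => i; rewrite inE tx subwE //; case: (i \in Y).
pose f Y := s2val (cid2 (enc Y)).
have fI Y : injective (f Y) by rewrite /f; case: cid2.
have fP (Y : {set 'I_n}) x : P x /\ t x = subw e Y <-> exists j, f Y j = x by rewrite /f; case: cid2.
have fPs (Y : {set 'I_n}) j : P (f Y j) /\ t (f Y j) = subw e Y by apply/fP; exists j.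
have fsupp Y j : supp (f Y j) = Y by apply: suppE; case: (fPs Y j).
pose good (l : seq T) := [/\ sorted ord l, {in l, forall x, P x},
  (\sum_(x <- l) t x)%R = subw e setT & C (size l)].
have suppP l : good l -> [/\ {in l, forall x, t x = subw e (supp x)},
    uniq (map supp l) & partition [set Y in map supp l] setT].
  move=> [_ lP lt _].
  have tsupp : {in l, forall x, t x = subw e (supp x)}.
    move=> x xl; have [Y tY] := subw_le eI (etrans (esym (sum_map_rem t xl)) lt).
    by rewrite tY (suppE x Y).
  have [] // := @uniq_cover1 _ (map supp l).
    move=> _ /mapP[x xl ->]; apply: contra_neq (t_neq0 x (lP x xl)) => s0.
    by rewrite tsupp // s0 /subw big_set0.
  move=> i; rewrite count_map count_sum.
  transitivity (subw e setT (e i)); last by rewrite subwE ?inE.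
  rewrite -lt w_sum.
  rewrite big_seq [RHS]big_seq; apply: eq_bigr => x xl /=.
  by rewrite [in RHS]tsupp ?subwE.
pose R (p : {p : {set {set 'I_n}} | partition p [set: 'I_n] && C #|p|}) (l : seq T) :=
  good l /\ val p = [set Y in map supp l].
apply: (@encodes_ext _ _ (fun l => exists p, R p l)) => [l|].
  split=> [[p []] //|gl]; have [tl ul pl] := suppP l gl.
  have pP : partition [set Y in map supp l] setT && C #|[set Y in map supp l]|.
    by rewrite pl cardsE (card_uniqP ul) size_map; case: gl.
  by exists (exist (fun p : {set {set 'I_n}} => partition p [set: 'I_n] && C #|p|) _ pP).
apply: encodes_tag => [p q l [_ pl] [_ ql]|p].
  by apply: val_inj; rewrite pl ql.
have /andP[pp pC] := valP p.
pose I : finType := {B : {set 'I_n} | B \in val p}.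
pose h (d : {dffun forall B : I, A #|val B|}) :=
  sort ord [seq f (val B) (d B) | B <- enum I].
have hP (d : {dffun forall B : I, A #|val B|}) x : reflect (exists B, x = f (val B) (d B)) (x \in h d).
  rewrite mem_sort; apply: (iffP mapP) => [[B _ ->]|[B ->]]; first by exists B.
  by exists B; rewrite ?mem_enum.
exists h => [d d' hd|l].
  apply/ffunP => B.
  have /hP [B' eqf] : f (val B) (d B) \in h d' by rewrite -hd; apply/hP; exists B.
  have BB : B = B' by apply: val_inj; rewrite -(fsupp _ (d B)) eqf fsupp.
  by case: B' / BB eqf => /fI.
split=> [[gl pl]|[d <-]]; last first.
  split; last first.
    apply/setP => Y; rewrite inE; apply/idP/mapP => [Yp|[x /hP[B ->] ->]].
      exists (f Y (d (exist (fun B => B \in val p) Y Yp))); last by rewrite fsupp.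
      by apply/hP; exists (exist (fun B => B \in val p) Y Yp).
    by rewrite fsupp (valP B).
  split; first exact: sort_sorted.
  - by move=> x /hP [B ->]; case: (fPs (val B) (d B)).
  - rewrite (perm_big _ (permEl (perm_sort _ _))) big_map big_enum /=.
    transitivity (\sum_(B : I) subw e (val B))%R.
      by apply: eq_big => [B|B _]; [rewrite inE | case: (fPs (val B) (d B))].
    by rewrite [in RHS]/subw (set_partition_big _ pp) /= [RHS]big_sub.
  - by rewrite size_sort size_map -cardE card_sig.
have [tl ul _] := suppP l gl.
have dex (B : I) : exists a, f (val B) a \in l.
  have : val B \in [set Y in map supp l] by rewrite -pl (valP B).
  rewrite inE => /mapP[x xl Bx].
  have /fP [a fa] : P x /\ t x = subw e (val B).
    by split; [case: gl => _ lP _ _; apply: lP | rewrite Bx tl].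
  by exists a; rewrite fa.
(* The object chosen on a block [B] is the element of [l] whose support is [B]. *)
pose d : {dffun forall B : I, A #|val B|} :=
  [ffun B => sval (cid (dex B))].
have dP B : f (val B) (d B) \in l by rewrite ffunE; case: cid.
exists d; apply: (sorted_eq ordTr ordA); [exact: sort_sorted | by case: gl |].
have sI := uniq_map_inj ul.
apply: uniq_perm; first 1 last.
- exact: map_uniq ul.
- move=> x; apply/hP/idP => [[B ->] //|xl].
  have xp : supp x \in val p by rewrite pl inE map_f.
  exists (exist (fun B => B \in val p) _ xp); apply: sI => //; by rewrite fsupp.
rewrite sort_uniq map_inj_uniq ?enum_uniq // => B B' eqf.
by apply: val_inj; rewrite -(fsupp _ (d B)) eqf fsupp.
Qed.

Lemma encodes_cset (s : setting) (C : pred nat) (A : cclass) (W : finType)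
    (T : eqType) (ord : rel T) (P : T -> Prop) (t : T -> {ffun W -> nat})
    (mu : {ffun W -> nat}) (n : nat) :
  total ord -> transitive ord -> antisymmetric ord ->
  adm s mu -> msz mu = n ->
  (forall x, P x -> t x != 0%R) ->
  (forall nu rho, (nu + rho)%R = mu -> encodes (A (msz nu)) (fun x => P x /\ t x = nu)) ->
  encodes (cset s C A n) (fun l : seq T =>
    [/\ sorted ord l, {in l, forall x, P x}, (\sum_(x <- l) t x)%R = mu & C (size l)]).
Proof.
move=> ordT ordTr ordA admu mun t_neq0 HA.
case: s admu => [m1|W1] /=.
  have [e eI mue] := labeled_support m1 mun.
  have {}mue : mu = subw e setT by rewrite mue /subw; apply: eq_bigl => i; rewrite inE.
  rewrite mue; apply: encodes_lset => // Y.
  by have := HA _ _ (etrans (subwC e Y) (esym mue)); rewrite msz_subw.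
apply: (encodes_ext (P := fun l : seq T => [/\ sorted ord l, {in l, forall x, P x},
   \sum_(x <- l) msz (t x) = n & C (size l)])) => [l|].
  split=> -[ls lP lt lC]; split=> //; last by rewrite -msz_sum lt.
  by apply: unlabeled_mszI => //; rewrite msz_sum lt.
apply: encodes_uset => // [x|i le_n]; first by rewrite msz_gt0; apply: t_neq0.
have [nu nui] := mszi i W1; have [rho rhoi] := mszi (n - i) W1.
have /HA : (nu + rho)%R = mu.
  by apply: unlabeled_mszI => //; rewrite mszD nui rhoi mun subnKC.
rewrite nui; apply: encodes_ext => x; rewrite -nui.
by split=> -[Px tx]; split=> //; rewrite ?tx //; apply: unlabeled_mszI.
Qed.

(** * Solutions of the system *)

Section PickleOrder.
Variable T : countType.

(** An arbitrary total order, serving only to select the sorted listing of a multiset. *)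
Definition pord (x y : T) := pickle x <= pickle y.

Lemma pord_total : total pord.
Proof. by move=> x y; apply: leq_total. Qed.

Lemma pord_trans : transitive pord.
Proof. by move=> y x z; apply: leq_trans. Qed.

Lemma pord_anti : antisymmetric pord.
Proof.
by move=> x y xy; apply: (pcan_inj pickleK); apply/eqP; rewrite eqn_leq.
Qed.

End PickleOrder.

Lemma encodes_empty (F : finType) (T : eqType) (P : T -> Prop) :
  encodes F P -> (forall x, ~ P x) -> #|F| = 0.
Proof.
move=> FP P0; rewrite -(card_ord 0); apply: (encodes_card FP).
by apply: encodes0 P0; apply: card_ord.
Qed.

Lemma adm_exists (s : setting) (n : nat) :
  exists (W : finType) (mu : {ffun W -> nat}), adm s mu /\ msz mu = n.
Proof.
case: s.
  exists 'I_n, [ffun=> 1]; split=> [w|]; first by rewrite ffunE.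
  by rewrite /msz (eq_bigr (fun=> 1)) ?sum_nat_const ?card_ord ?muln1 // => w _; rewrite ffunE.
exists unit, [ffun=> n]; split; first exact: card_unit.
by rewrite /msz (bigD1 tt) //= big1 ?ffunE ?addn0 // => -[].
Qed.

(** A model for a class about which only the cardinalities are known: an object is its weight
    together with a number below the cardinality of that size. *)
Lemma encodes_indexed (A : cclass) (W : finType) (nu : {ffun W -> nat}) :
  encodes (A (msz nu)) (fun x : {ffun W -> nat} * nat =>
    x.2 < #|A (msz x.1)| /\ x.1 = nu).
Proof.
have := encodes_ord #|A (msz nu)|.
move/(encodes_eqcard (card_ord _)).
apply: encodes_map (fun j => (nu, j)) _ _ => [i j _ _ [] //|[m j] /=].
by split=> [[jA mn]|[i iA [<- <-]] //]; exists j; rewrite -?mn.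
Qed.

(** * Cardinalities of the constructions and the fixed point for [S_X] *)

Section Cardinality.
Variable s : setting.

(** Both products encode the same predicate on indexed objects, so a product sees only the
    cardinalities of its factors, those of [B] merely at sizes that some object of [A] leaves
    over. *)
Lemma card_cprod_eq (A A' B B' : cclass) (n : nat) :
  (forall i, i <= n -> #|A i| = #|A' i|) ->
  (forall i j, i + j = n -> 0 < #|A i| -> #|B j| = #|B' j|) ->
  #|cprod s A B n| = #|cprod s A' B' n|.
Proof.
move=> eqA eqB; have [W [mu [admu mun]]] := adm_exists s n.
have le_n (nu rho : {ffun W -> nat}) : (nu + rho)%R = mu -> msz nu + msz rho = n.
  by move=> numu; rewrite -mszD numu.
apply: encodes_card.
  apply: encodes_cprod admu mun _ _ => nu rho _; first exact: encodes_indexed.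
  by move=> _; apply: encodes_indexed.
apply: encodes_cprod admu mun _ _ => nu rho /le_n le.
  by apply: encodes_eqcard (encodes_indexed _ _); rewrite eqA // -le leq_addr.
rewrite -eqA => [A_gt0|]; last by rewrite -le leq_addr.
by apply: encodes_eqcard (encodes_indexed _ _); rewrite (eqB _ _ le).
Qed.

Lemma card_cset_eq (C : pred nat) (A A' : cclass) (n : nat) : #|A 0| = 0 ->
  (forall i, i <= n -> #|A i| = #|A' i|) -> #|cset s C A n| = #|cset s C A' n|.
Proof.
move=> A0 eqA; have [W [mu [admu mun]]] := adm_exists s n.
have pos (x : {ffun W -> nat} * nat) : x.2 < #|A (msz x.1)| -> x.1 != 0%R.
  by apply: contraL => /eqP ->; rewrite msz0 A0.
apply: encodes_card.
  apply: (encodes_cset C (@pord_total _) (@pord_trans _) (@pord_anti _) admu mun pos).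
  by move=> nu rho _; apply: encodes_indexed.
apply: (encodes_cset C (@pord_total _) (@pord_trans _) (@pord_anti _) admu mun pos).
move=> nu rho numu.
apply: encodes_eqcard (encodes_indexed _ _); apply: eqA.
by rewrite -mun -numu mszD leq_addr.
Qed.

Lemma card_csum (A B : cclass) n : #|csum A B n| = #|A n| + #|B n|.
Proof. exact: card_sum. Qed.

Lemma cprod_no_size0 (A B : cclass) : #|A 0| = 0 -> #|cprod s A B 0| = 0.
Proof.
move=> A0; apply/eqP; rewrite -leqn0 leqNgt; apply/card_gt0P.
case: s => /= -[[i [a b]] _].
  have : #|i| = 0 by have := max_card i; rewrite card_ord leqn0 => /eqP.
  by move: #|i| a b => k a _ k0; have /card_gt0P : exists a, a \in A k; [exists a | rewrite k0 A0].
have i0 : i = 0 :> nat by case: i {a b} => -[].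
have : 0 < #|A i| by apply/card_gt0P; exists a.
by rewrite i0 A0.
Qed.

Lemma cset_no_size0 (C : pred nat) (A : cclass) :
  ~~ C 0 -> #|A 0| = 0 -> #|cset s C A 0| = 0.
Proof.
move=> C0 A0; have [W [mu [admu mun]]] := adm_exists s 0.
have pos (x : {ffun W -> nat} * nat) : x.2 < #|A (msz x.1)| -> x.1 != 0%R.
  by apply: contraL => /eqP ->; rewrite msz0 A0.
apply: (encodes_empty (encodes_cset C (@pord_total _) (@pord_trans _)
  (@pord_anti _) admu mun pos (fun nu rho _ => encodes_indexed A nu))) => l [_ lP lt lC].
case: l lP lt lC => [|x l] lP lt lC; first by rewrite lC in C0.
have : msz (\sum_(x <- x :: l) x.1)%R = 0 by rewrite lt mun.
rewrite big_cons mszD => /eqP; rewrite addn_eq0 msz_eq0 => /andP[].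
by rewrite (negPf (pos x _)) // lP ?mem_head.
Qed.

Lemma encodes_catom (W : finType) (nu : {ffun W -> nat}) :
  encodes (catom (msz nu)) (fun w => True /\ delta w = nu).
Proof.
have [nu1|nu1] := eqVneq (msz nu) 1; last first.
  apply: encodes0 => [|w [_ wnu]]; first by rewrite card_ord (negPf nu1).
  by rewrite -wnu msz_delta in nu1.
have [w wnu] : exists w, delta w = nu.
  have [w] : exists w, 0 < nu w.
    apply/existsP; apply: contra_eqT nu1 => /existsPn H.
    by rewrite /msz big1 // => w _; apply/eqP; rewrite -leqn0 leqNgt; apply: H.
  rewrite lt0n => nuw; exists w; apply/ffunP => x; rewrite ffunE.
  move: nu1; rewrite /msz (bigD1 w) //=.
  case nuwE: (nu w) nuw => [|[|k]] // _.
  move=> [] /eqP; rewrite add0n sum_nat_eq0 => /forall_inP nu0.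
  by have [->|xw] := eqVneq x w; [rewrite nuwE | rewrite (eqP (nu0 _ xw))].
apply: (encodes_ext (P := fun x => x = w)) => [x|]; last first.
  by apply: encodes1; rewrite card_ord nu1.
split=> [->|[_]] //; rewrite -wnu => /ffunP/(_ x); rewrite !ffunE eqxx.
by case: eqP.
Qed.

(** A multiset of atoms of weight [mu] contains each [w] exactly [mu w] times: the sorted list [m]
    is the only candidate, and its length is [n]. *)
Lemma card_cset_catom (C : pred nat) n : #|cset s C catom n| = C n.
Proof.
have [W [mu [admu mun]]] := adm_exists s n.
have pos (w : W) : True -> delta w != 0%R by rewrite -msz_gt0 msz_delta.
have enc := encodes_cset C (@pord_total _) (@pord_trans _)
  (@pord_anti _) admu mun pos (fun nu rho _ => encodes_catom nu).
have szl (l : seq W) : (\sum_(x <- l) delta x)%R = mu -> size l = n.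
  move=> lm; rewrite -mun -lm msz_sum -sum1_size.
  by apply: eq_bigr => w _; rewrite msz_delta.
have [Cn|Cn] := boolP (C n); last first.
  by apply: (encodes_empty enc) => l [_ _ /szl ->] nC; rewrite nC in Cn.
pose m := sort (@pord _) (flatten [seq nseq (mu w) w | w <- enum W]).
have mE : (\sum_(x <- m) delta x)%R = mu.
  apply/ffunP => w; rewrite w_sum sum_of_uset (bigD1 w) //= ffunE eqxx muln1.
  by rewrite big1 ?addn0 // => x xw; rewrite ffunE eq_sym (negPf xw) muln0.
have cnt (l : seq W) : (\sum_(x <- l) delta x)%R = mu -> forall w, count_mem w l = mu w.
  move=> <- w; rewrite count_sum w_sum; apply: eq_bigr => x _.
  by rewrite ffunE /= eq_sym.
suff enc1 : encodes (cset s C catom n) (fun l => l = m).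
  by apply: (etrans (encodes_card enc1 (encodes1 m card_unit))); rewrite card_unit.
apply: encodes_ext enc => l; split=> [[ls _ lm lC]|->].
  apply: (sorted_eq (@pord_trans _) (@pord_anti _)) => //.
    exact: (sort_sorted (@pord_total _)).
  by apply/allP => w _; rewrite /= !cnt.
split=> //; [exact: (sort_sorted (@pord_total _)) | by rewrite szl].
Qed.

Definition clsL : cclass := csum catom (cset_ge s 2 catom).

(** One object in each positive size: an object of [L] amounts to a nonzero weight, that is, to the
    content of one node. *)
Lemma card_clsL n : #|clsL n| = (0 < n).
Proof. by rewrite card_csum card_ord card_cset_catom; case: n => [|[]]. Qed.

Definition clsSX (SX : cclass) : cclass :=
  cprod s clsL (cset_ge s 1 (csum clsL SX)).

(** The factor [clsL] uses up at least one atom, so size [n] of the right-hand side depends only on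
    smaller sizes of its argument. Existence and uniqueness of solutions both rest on this. *)
Lemma card_clsSX_eq (A B : cclass) n : #|A 0| = 0 ->
  (forall i, i < n -> #|A i| = #|B i|) -> #|clsSX A n| = #|clsSX B n|.
Proof.
move=> A0 eqA; apply: card_cprod_eq => // i j ijn; rewrite card_clsL => i_gt0.
have {}i_gt0 : 0 < i by case: i i_gt0 {ijn}.
apply: card_cset_eq => [|k kj]; first by rewrite card_csum card_clsL A0.
by rewrite card_csum [RHS]card_csum eqA // -ijn (leq_ltn_trans kj) // -[ltnLHS]add0n ltn_add2r.
Qed.

Definition sx_step (a : nat -> nat) (n : nat) : nat := #|clsSX (fun i => 'I_(a i)) n|.

(** Each application of [sx_step] settles one more size, starting with size 0; hence [n.+1]
    iterations for the value at [n], after which it is stable. *)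
Definition sx_card (n : nat) : nat := iter n.+1 sx_step (fun=> 0) n.

Lemma sx_cardE n : sx_card n = sx_step sx_card n.
Proof.
have it0 k : iter k sx_step (fun=> 0) 0 = 0.
  by case: k => //= k; apply: cprod_no_size0; rewrite card_clsL.
have stab k m : m < k -> iter k sx_step (fun=> 0) m = sx_card m.
  elim/ltn_ind: k m => k IH m; rewrite /sx_card.
  case: k IH => // k IH mk; rewrite !iterS; apply: card_clsSX_eq => [|i im].
    by rewrite card_ord it0.
  by rewrite !card_ord [LHS]IH // ?[RHS]IH // (leq_trans im).
by rewrite {1}/sx_card iterS; apply: card_clsSX_eq => [|i im]; rewrite !card_ord ?it0 ?stab.
Qed.

End Cardinality.

Lemma ciso_card (A B : cclass) n : ciso A B -> #|A n| = #|B n|.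
Proof. by move=> /(_ n) [f /bij_eq_card]. Qed.

Lemma card_ciso (A B : cclass) : (forall n, #|A n| = #|B n|) -> ciso A B.
Proof. by move=> eqAB n; apply: card_bij. Qed.

Lemma ciso_refl (A : cclass) : ciso A A.
Proof. by apply: card_ciso. Qed.

Lemma solution_exists (s : setting) : exists X, solution s X.
Proof.
pose SX : cclass := fun n => 'I_(sx_card s n).
have cardSX n : #|SX n| = #|clsSX s SX n| by rewrite card_ord sx_cardE.
have L0 : #|clsL s 0| = 0 by rewrite card_clsL.
have SX0 : #|SX 0| = 0 by rewrite cardSX; apply: cprod_no_size0.
pose SC := cset_ge s 2 (csum (clsL s) SX).
exists (SystemClasses (cprod s (clsL s) SC) (cset_eq s 2 SX) (cprod s SX SX) SC
  SX (clsL s) (cset_ge s 3 catom)).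
split; first split; first split; rewrite /no_size0 /=.
- exact: cprod_no_size0.
- exact: cset_no_size0.
- exact: cprod_no_size0.
- split=> //; apply: cset_no_size0 => //; last by rewrite card_ord.
  by rewrite card_csum L0 SX0.
by do 2!split=> //=; try exact: ciso_refl; exact: card_ciso.
Qed.

Section SolutionCards.
Variables (s : setting) (X : system_classes).
Hypothesis solX : solution s X.

Lemma card_cL n : #|cL X n| = (0 < n).
Proof.
case: solX => _ [_ [_ _ /(ciso_card n) -> _]]; exact: card_clsL.
Qed.

Lemma card_cK n : #|cK X n| = (3 <= n).
Proof. by case: solX => _ [_ [_ _ _ /(ciso_card n) ->]]; apply: card_cset_catom. Qed.

Lemma cS_X_no_size0 : #|cS_X X 0| = 0.
Proof. by case: solX => [[_ [_ ? _ _]] _]. Qed.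

Lemma cLS_X_no_size0 : #|csum (cL X) (cS_X X) 0| = 0.
Proof. by rewrite card_csum card_cL cS_X_no_size0. Qed.

Lemma card_cS_X_clsSX n : #|cS_X X n| = #|clsSX s (cS_X X) n|.
Proof.
case: solX => _ [_ [_ /(ciso_card n) -> _ _]].
apply: card_cprod_eq => [i _|i j _ _]; first by rewrite card_cL card_clsL.
apply: card_cset_eq => [|k _]; first exact: cLS_X_no_size0.
by rewrite card_csum [RHS]card_csum card_cL card_clsL.
Qed.

End SolutionCards.

Lemma solution_unique (s : setting) (X Y : system_classes) :
  solution s X -> solution s Y -> classes_iso X Y.
Proof.
move=> sX sY.
have eqL n : #|cL X n| = #|cL Y n| by rewrite (card_cL sX) (card_cL sY).
have eqSX n : #|cS_X X n| = #|cS_X Y n|.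
  elim/ltn_ind: n => n IH; rewrite (card_cS_X_clsSX sX) (card_cS_X_clsSX sY).
  by apply: card_clsSX_eq => //; apply: cS_X_no_size0 sX.
have eqSC n : #|cS_C X n| = #|cS_C Y n|.
  case: (sX) (sY) => _ [_ [/(ciso_card n) -> _ _ _]] [_ [_ [/(ciso_card n) -> _ _ _]]].
  apply: card_cset_eq => [|i _]; first exact: cLS_X_no_size0 sX.
  by rewrite !card_csum eqL eqSX.
split; split; apply: card_ciso => n //; last by rewrite (card_cK sX) (card_cK sY).
- case: (sX) (sY) => _ [[/(ciso_card n) -> _ _] _] [_ [[/(ciso_card n) -> _ _] _]].
  exact: card_cprod_eq.
- case: (sX) (sY) => _ [[_ /(ciso_card n) -> _] _] [_ [[_ /(ciso_card n) -> _] _]].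
  by apply: card_cset_eq => //; apply: cS_X_no_size0 sX.
- case: (sX) (sY) => _ [[_ _ /(ciso_card n) ->] _] [_ [[_ _ /(ciso_card n) ->] _]].
  exact: card_cprod_eq.
Qed.

(** * Weighted trees up to isomorphism *)

Section Codes.
Variable W : finType.
Local Notation code := (rtree {ffun W -> nat}).
Implicit Types (a b c d : code) (s : seq code).

Definition tot c : {ffun W -> nat} := (\sum_(m <- nodes c) m)%R.
Definition csz c := msz (tot c).

Lemma tot_node m s : tot (Node m s) = (m + \sum_(c <- s) tot c)%R.
Proof. by rewrite /tot /= big_cons big_flatten big_map. Qed.

Lemma csz_node m s : csz (Node m s) = msz m + \sum_(c <- s) csz c.
Proof. by rewrite /csz tot_node mszD msz_sum. Qed.

(* Sizes are compared first: this makes the heavier side of an edge the larger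
   one, ties being broken arbitrarily. *)
Definition cord c d := (csz c < csz d) || ((csz c == csz d) && pord c d).

Lemma cord_total : total cord.
Proof.
by move=> c d; rewrite /cord; case: ltngtP => //= _; apply: pord_total.
Qed.

Lemma cord_trans : transitive cord.
Proof.
move=> d c e; rewrite /cord => /orP[cd|/andP[/eqP -> cd]] /orP[de|/andP[/eqP <- de]].
- by rewrite (ltn_trans cd de).
- by rewrite cd.
- by rewrite de.
- by rewrite eqxx (pord_trans cd de) orbT.
Qed.

Lemma cord_anti : antisymmetric cord.
Proof.
move=> c d; rewrite /cord; case: ltngtP => //= _ cd; exact: pord_anti cd.
Qed.

Lemma cord_csz c d : ~~ cord c d -> csz d <= csz c.
Proof. by rewrite /cord negb_or -leqNgt => /andP[]. Qed.

Lemma sort_cord_id s : sorted cord s -> sort cord s = s.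
Proof. exact: sorted_sort cord_trans _. Qed.

Lemma sort_cordP s s' : reflect (sort cord s = sort cord s') (perm_eq s s').
Proof. exact: perm_sortP cord_total cord_trans cord_anti _ _. Qed.

(** Nonzero weights because nodes stand for nonempty cliques; sorted kids so that each isomorphism
    type of rooted weighted trees has one valid code. *)
Fixpoint valid c : bool :=
  let: Node m s := c in [&& m != 0%R, sorted cord s & all valid s].

Lemma valid_csz c : valid c -> 0 < csz c.
Proof. by case: c => m s /= /andP[m0 _]; rewrite csz_node addn_gt0 msz_gt0 m0. Qed.

Lemma valid_tot c : valid c -> tot c != 0%R.
Proof. by move/valid_csz; rewrite msz_gt0. Qed.

(** Joining the roots of [a] and [b] by an edge gives one unrooted tree, of which [add a b] and
    [add b a] are the rootings at the two ends of this edge. [rest] cuts the edge again. *)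
Definition add a b := Node (root a) (sort cord (b :: kids a)).
Definition rest c a := Node (root c) (rem a (kids c)).
Definition internal c := kids c != [::].

Lemma valid_kid c a : valid c -> a \in kids c -> valid a.
Proof. by case: c => m s /= /and3P[_ _ /allP]; apply. Qed.

Lemma csz_kid c a : valid c -> a \in kids c -> csz a < csz c.
Proof.
case: c => m s /= /andP[m0 _] ac; rewrite csz_node (sum_map_rem _ ac) addnCA.
by rewrite -[ltnLHS]addn0 ltn_add2l addn_gt0 msz_gt0 m0.
Qed.

Lemma valid_add a b : valid a -> valid b -> valid (add a b).
Proof.
case: a => m s /= /and3P[-> _ /allP vs] vb; rewrite (sort_sorted cord_total) /=.
by apply/allP => c; rewrite mem_sort inE => /predU1P[-> //|/vs].
Qed.

Lemma valid_rest c a : valid c -> valid (rest c a).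
Proof.
case: c => m s /= /and3P[-> ss /allP vs] /=.
rewrite (subseq_sorted cord_trans (rem_subseq _ _) ss) /=.
by apply/allP => c /mem_rem/vs.
Qed.

Lemma tot_add a b : tot (add a b) = (tot a + tot b)%R.
Proof.
case: a => m s; rewrite /add !tot_node (perm_big _ (permEl (perm_sort _ _))).
by rewrite big_cons /= [(tot b + _)%R]addrC addrA.
Qed.

Lemma mem_add a b c : c \in kids (add a b) = (c == b) || (c \in kids a).
Proof. by rewrite mem_sort inE. Qed.

Lemma size_kids_add a b : size (kids (add a b)) = (size (kids a)).+1.
Proof. by rewrite size_sort. Qed.

Lemma rest_add a b : valid a -> rest (add a b) b = a.
Proof.
case: a => m s /= /and3P[_ ss _]; rewrite /rest /add /=; congr Node.
have bs : b \in sort cord (b :: s) by rewrite mem_sort mem_head.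
apply: (sorted_eq cord_trans cord_anti) => //.
  apply: (subseq_sorted cord_trans (rem_subseq _ _)).
  exact: sort_sorted cord_total _.
rewrite -(perm_cons b) -(permPl (perm_to_rem bs)).
by rewrite (permPl (permEl (perm_sort _ _))).
Qed.

Lemma add_rest c a : valid c -> a \in kids c -> add (rest c a) a = c.
Proof.
case: c => m s /= /and3P[_ ss _] ac; rewrite /rest /add /=; congr Node.
rewrite -[RHS]sort_cord_id //; apply/sort_cordP.
by rewrite perm_sym; apply: perm_to_rem.
Qed.

(** The test [internal a] keeps the root off the leaves: a one-node kid never attracts the root,
    however heavy it is. *)
Definition is_bigkid c a := internal a && ~~ cord a (rest c a).
Definition bigkid c := ohead [seq a <- kids c | is_bigkid c a].
Definition centered c := bigkid c == None.

Lemma bigkidP c a : bigkid c = Some a -> a \in kids c /\ is_bigkid c a.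
Proof.
rewrite /bigkid => h; have : a \in [seq a <- kids c | is_bigkid c a].
  by case: filter h => //= x s [->]; apply: mem_head.
by rewrite mem_filter => /andP[].
Qed.

(* A big kid is at least as heavy as the rest of the tree, which contains the
   other kids and the root: there is at most one. *)
Lemma bigkid_eq c a : valid c -> a \in kids c -> is_bigkid c a -> bigkid c = Some a.
Proof.
move=> vc ac big_a.
case E : (bigkid c) => [a'|]; last first.
  move/eqP: E; rewrite /bigkid; have : a \in [seq a <- kids c | is_bigkid c a].
    by rewrite mem_filter big_a.
  by case: filter.
have [a'c big_a'] := bigkidP E; congr Some; apply/eqP/negPn/negP => neq.
have lt x y : x \in kids c -> y \in kids c -> x != y -> csz x < csz (rest c y).
  by move=> xc yc xy; apply: csz_kid (valid_rest y vc) _; apply: rem_mem.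
have := leq_trans (lt _ _ a'c ac neq) (cord_csz (proj2 (andP big_a))).
have neq' : a != a' by rewrite eq_sym.
have := leq_trans (lt _ _ ac a'c neq') (cord_csz (proj2 (andP big_a'))).
by rewrite ltnNge => /negP h /ltnW.
Qed.

Lemma is_bigkid_add a b : valid b -> internal a -> is_bigkid (add b a) a = ~~ cord a b.
Proof. by move=> vb ia; rewrite /is_bigkid ia rest_add. Qed.

Lemma bigkid_add a b : valid a -> valid b -> internal a -> ~~ cord a b ->
  bigkid (add b a) = Some a.
Proof.
move=> va vb ia ab; apply: bigkid_eq; rewrite ?is_bigkid_add ?mem_add ?eqxx //.
exact: valid_add.
Qed.

Definition step c := if bigkid c is Some a then add a (rest c a) else c.

Definition level c := if bigkid c is Some a then csz a else 0.

Lemma step_valid c : valid c -> valid (step c).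
Proof.
move=> vc; rewrite /step; case E: bigkid => [a|] //; have [ac _] := bigkidP E.
by apply: valid_add; [apply: valid_kid ac | apply: valid_rest].
Qed.

Lemma step_tot c : valid c -> tot (step c) = tot c.
Proof.
move=> vc; rewrite /step; case E: bigkid => [a|] //; have [ac _] := bigkidP E.
by rewrite -[in RHS](add_rest vc ac) !tot_add addrC.
Qed.

Lemma step_kids c : size (kids c) != 1 -> size (kids (step c)) != 1.
Proof.
rewrite /step; case E: bigkid => [a|] // _; have [_ /andP[]] := bigkidP E.
by rewrite /internal size_kids_add; case: kids.
Qed.

(** After the root has moved to [a], the old root side is the smaller side of the edge and cannot be
    the new big kid. A new big kid is therefore a kid of [a], hence lighter than [a]: the root never
    turns back. *)
Lemma step_level c : valid c -> level c != 0 -> level (step c) < level c.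
Proof.
move=> vc; rewrite /level /step; case E: (bigkid c) => [a|] // _.
have [ac /andP[ia big_a]] := bigkidP E.
have va := valid_kid vc ac; have vr := valid_rest a vc.
case E' : bigkid => [a'|]; last exact: valid_csz.
have [] := bigkidP E'; rewrite mem_add => /predU1P[->|a'a _].
  rewrite /is_bigkid rest_add // => /andP[_ ra].
  by have := cord_total a (rest c a); rewrite (negPf big_a) (negPf ra).
exact: csz_kid.
Qed.

(** [csz c] iterations are enough since the level, the size of a proper subtree, is below [csz c]
    and drops at each move; further iterations do nothing. *)
Definition nf c := iter (csz c) step c.

Lemma level0 c : valid c -> (level c == 0) = centered c.
Proof.
move=> vc; rewrite /level /centered; case E: bigkid => [a|] //=.
by have [ac _] := bigkidP E; rewrite eqn0Ngt valid_csz // (valid_kid vc).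
Qed.

Lemma step_centered c : centered c -> step c = c.
Proof. by rewrite /centered /step => /eqP ->. Qed.

Lemma iter_step_level k c : valid c -> level c <= k -> centered (iter k step c).
Proof.
elim: k c => [|k IH] c vc le_k; first by rewrite -level0 // -leqn0.
rewrite iterSr; apply: IH; first exact: step_valid.
have [l0|/(step_level vc)] := eqVneq (level c) 0; last first.
  by move=> lt; rewrite -ltnS; apply: leq_trans lt le_k.
by rewrite step_centered ?l0 // -level0 // l0.
Qed.

Lemma nf_centered c : valid c -> centered (nf c).
Proof.
move=> vc; apply: iter_step_level => //; rewrite /level.
by case E: bigkid => [a|] //; have [ac _] := bigkidP E; apply/ltnW/csz_kid.
Qed.

Lemma nf_id c : centered c -> nf c = c.
Proof. by move=> cc; rewrite /nf; elim: csz => //= k ->; apply: step_centered. Qed.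

Lemma nf_step c : valid c -> nf (step c) = nf c.
Proof.
move=> vc; rewrite /nf {1}/csz step_tot // -/(csz c) -iterSr iterS step_centered //.
exact: nf_centered.
Qed.

(** Unless both sides are equal, the rooting at the end of the smaller side has the larger side as
    its big kid, and one [step] turns it into the other rooting. *)
Lemma nf_add a b : valid a -> valid b -> internal a -> internal b ->
  nf (add a b) = nf (add b a).
Proof.
move=> va vb ia ib; wlog ab : a b va vb ia ib / cord b a => [th|].
  have /orP[] := cord_total a b => [ab|]; last exact: th.
  by apply/esym/th.
have [->|neq] := eqVneq a b; first by [].
have nab : ~~ cord a b.
  by apply: contra_neqN neq => ab'; apply: cord_anti; rewrite ab ab'.
rewrite -[RHS]nf_step ?valid_add //; congr nf.
by rewrite /step bigkid_add // rest_add.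
Qed.

Lemma nf_ind (P : code -> Prop) c :
  (forall c, valid c -> P c -> P (step c)) -> valid c -> P c -> P (nf c) /\ valid (nf c).
Proof.
move=> Pstep vc Pc; rewrite /nf; elim: (csz c) => //= k [Pk vk].
by split; [apply: Pstep | apply: step_valid].
Qed.

Lemma nf_valid c : valid c -> valid (nf c).
Proof. by move=> vc; have [] := @nf_ind (fun=> True) c. Qed.

Lemma nf_tot c : valid c -> tot (nf c) = tot c.
Proof.
move=> vc; have [] // := @nf_ind (fun d => tot d = tot c) c.
by move=> d vd <-; apply: step_tot.
Qed.

Lemma nf_kids c : valid c -> size (kids c) != 1 -> size (kids (nf c)) != 1.
Proof.
by move=> vc; case/(@nf_ind (fun d => size (kids d) != 1)) => // d _; apply: step_kids.
Qed.

End Codes.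

Lemma encodes_restrict (F : finType) (T : eqType) (P : T -> Prop) (Q : pred T) :
  encodes F P -> exists G : finType, encodes G (fun x => P x /\ Q x).
Proof.
move=> [f fI fP]; exists {i | Q (f i)}.
exists (f \o val) => [|x]; first exact: inj_comp fI val_inj.
split=> [[/fP[i <-] Qx]|[[i Qi] /= <-]]; first by exists (exist _ i Qx).
by split=> //; apply/fP; exists i.
Qed.

(** * The classes of a solution as sets of codes *)

Section Counting.
Variables (s : setting) (X : system_classes) (W : finType).
Hypothesis solX : solution s X.
Local Notation code := (rtree {ffun W -> nat}).
Implicit Types (mu : {ffun W -> nat}) (c : code).

Lemma encodes_cL mu : encodes (cL X (msz mu)) (fun m : {ffun W -> nat} => m != 0%R /\ m = mu).
Proof.
have cLE := card_cL solX (msz mu); rewrite msz_gt0 in cLE.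
have [mu0|mu_neq0] := eqVneq mu 0%R.
  by apply: encodes0 => [|m [m0 mm]]; [rewrite cLE mu0 eqxx | rewrite mm mu0 eqxx in m0].
apply: (encodes_ext (P := fun m => m = mu)) => [m|]; first by split=> [->|[]].
by apply: encodes1; rewrite cLE mu_neq0.
Qed.

Definition code_of mu c : Prop := valid c /\ tot c = mu.

(** The common shape of [S_X] ([k = 1]) and [T_S] ([k = 2]): a root and a forest. The forest has to
    be encoded only for weights left over by a nonzero root, as the induction for [S_X] demands. *)
Lemma encodes_plant (B : cclass) (k : nat) mu :
  (forall nu rho, (nu + rho)%R = mu -> nu != 0%R ->
     encodes (B (msz rho)) (fun l : seq code => [/\ sorted (@cord W) l, {in l, forall c, valid c},
       (\sum_(c <- l) tot c)%R = rho & k <= size l])) ->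
  adm s mu ->
  encodes (cprod s (cL X) B (msz mu)) (fun c => code_of mu c /\ k <= size (kids c)).
Proof.
move=> encB admu.
have enc := @encodes_cprod s (cL X) B W _ _ (fun m => m != 0%R)
  (fun l => [/\ sorted (@cord W) l, {in l, forall c, valid c} & k <= size l])
  id (fun l : seq code => (\sum_(c <- l) tot c)%R) mu (msz mu) admu erefl.
apply: encodes_map (fun z : _ * seq code => Node z.1 z.2) _ _ (enc _ _).
- by move=> [m l] [m' l'] _ _ [-> ->].
- move=> [m l]; split=> [[[/= /and3P[m0 sl /allP vl]]]|[[m' l'] [/= m0 [sl vl kl] ml] [<- <-]]].
    by rewrite tot_node => ml kl; exists (m, l).
  by split=> //; split; [rewrite /= m0 sl; apply/allP | rewrite tot_node].
- by move=> nu rho _; apply: encodes_cL.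
- move=> nu rho numu; rewrite (card_cL solX) lt0b msz_gt0 => nu0.
  by apply: encodes_ext (encB _ _ numu nu0) => l; split=> [[]|[[]]].
Qed.

Lemma encodes_forest (A : cclass) (C : pred nat) (P : pred code) mu : adm s mu ->
  (forall nu rho, (nu + rho)%R = mu -> encodes (A (msz nu)) (fun c => code_of nu c /\ P c)) ->
  encodes (cset s C A (msz mu)) (fun l : seq code => [/\ sorted (@cord W) l,
    {in l, forall c, valid c /\ P c}, (\sum_(c <- l) tot c)%R = mu & C (size l)]).
Proof.
move=> admu HA; apply: (encodes_cset C (@cord_total W) (@cord_trans W) (@cord_anti W)) => //.
  by move=> c [/valid_tot].
move=> nu rho numu; apply: encodes_ext (HA _ _ numu) => c; rewrite /code_of.
by split=> [[[]]|[[]]].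
Qed.

(** [L] supplies the one-node codes and [S_X] the internal ones, so an object of the sum is an
    arbitrary valid code, that is, an arbitrary kid. *)
Lemma encodes_cLS_X mu :
  encodes (cS_X X (msz mu)) (fun c => code_of mu c /\ internal c) ->
  encodes (csum (cL X) (cS_X X) (msz mu)) (fun c => code_of mu c /\ true).
Proof.
move=> encSX.
have encL : encodes (cL X (msz mu)) (fun c => code_of mu c /\ ~~ internal c).
  apply: encodes_map (fun m => Node m [::]) _ _ (encodes_cL mu).
    by move=> m m' _ _ [->].
  move=> [m l]; rewrite /code_of /internal /= negbK; split.
    by move=> [[/and3P[m0 _ _]]] + /eqP l0; rewrite l0 tot_node big_nil addr0; exists m.
  by move=> [m' [m0 <-] [<- <-]]; rewrite tot_node big_nil addr0 m0.
apply: encodes_ext (encodes_sum _ encL encSX) => [c|c [_ /negP] + [_]] //.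
split=> [[[]|[]] //|[cm _]]; have [ic|ic] := boolP (internal c); by [right | left].
Qed.

(** A subtree hanging from an edge at an internal node: the edge upwards counts in the degree of its
    root, so one kid suffices, whereas the root of an object of [T_S] needs two. The induction is on
    the size of the weight. *)
Lemma encodes_cS_X mu : adm s mu ->
  encodes (cS_X X (msz mu)) (fun c => code_of mu c /\ internal c).
Proof.
have [n] := ubnP (msz mu); elim: n mu => // n IH mu /ltnSE-le_n admu.
have /(ciso_card (msz mu))/esym eqc : ciso (cS_X X) (cprod s (cL X) (cset_ge s 1 (csum (cL X) (cS_X X)))).
  by case: solX => _ [_ []].
apply: encodes_eqcard eqc _.
apply: (encodes_ext (P := fun c => code_of mu c /\ 1 <= size (kids c))) => [c|].
  by rewrite /internal -size_eq0 lt0n.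
apply: encodes_plant => // nu rho numu nu0.
have admr : adm s rho by apply: (@admDr _ _ nu); rewrite numu.
have lt_n : msz rho < n.
  by apply: leq_trans le_n; rewrite -numu mszD -[ltnLHS]add0n ltn_add2r msz_gt0.
apply: encodes_ext (@encodes_forest _ (fun k => 1 <= k) predT rho admr _) => [l|nu' rho' E].
  by split=> -[sl vl tl kl]; split=> // c /vl // [].
apply: encodes_cLS_X; apply: IH; last by apply: (@admDl _ _ _ rho'); rewrite E.
by apply: leq_ltn_trans lt_n; rewrite -E mszD leq_addr.
Qed.

Lemma encodes_cT_S mu : adm s mu ->
  encodes (cT_S X (msz mu)) (fun c => code_of mu c /\ 1 < size (kids c)).
Proof.
move=> admu.
have /(ciso_card (msz mu))/esym eqc : ciso (cT_S X) (cprod s (cL X) (cS_C X)).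
  by case: solX => _ [[]].
apply: encodes_eqcard eqc _; apply: encodes_plant => // nu rho numu nu0.
have admr : adm s rho by apply: (@admDr _ _ nu); rewrite numu.
have /(ciso_card (msz rho))/esym eqc : ciso (cS_C X) (cset_ge s 2 (csum (cL X) (cS_X X))).
  by case: solX => _ [_ []].
apply: encodes_eqcard eqc _.
apply: encodes_ext (@encodes_forest _ (fun k => 2 <= k) predT rho admr _) => [l|nu' rho' E].
  by split=> -[sl vl tl kl]; split=> // c /vl // [].
by apply/encodes_cLS_X/encodes_cS_X/(@admDl _ _ _ rho'); rewrite E.
Qed.

Definition half_edges mu (z : code * code) : Prop :=
  [/\ valid z.1 /\ internal z.1, valid z.2 /\ internal z.2 & (tot z.1 + tot z.2)%R = mu].

Lemma encodes_cT_StoS mu : adm s mu -> encodes (cT_StoS X (msz mu)) (half_edges mu).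
Proof.
move=> admu.
have /(ciso_card (msz mu))/esym eqc : ciso (cT_StoS X) (cprod s (cS_X X) (cS_X X)).
  by case: solX => _ [[]].
have encSX nu : adm s nu ->
    encodes (cS_X X (msz nu)) (fun c => (valid c /\ internal c) /\ tot c = nu).
  by move/encodes_cS_X; apply: encodes_ext => c; split=> [[[]]|[[]]].
apply: encodes_eqcard eqc _.
pose P c := valid c /\ internal c.
apply: (@encodes_cprod s _ _ W _ _ P P (@tot W) (@tot W) mu _ admu erefl) => nu rho numu.
  by apply/encSX/(@admDl _ _ _ rho); rewrite numu.
by move=> _; apply/encSX/(@admDr _ _ nu); rewrite numu.
Qed.

(** An unordered pair is stored in [cord]-increasing order, equal sides included; the pairs of
    [T_StoS] that remain are the strictly decreasing ones. *)
Lemma encodes_cT_SS mu : adm s mu ->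
  encodes (cT_SS X (msz mu)) (fun z => half_edges mu z /\ cord z.1 z.2).
Proof.
move=> admu.
have /(ciso_card (msz mu))/esym eqc : ciso (cT_SS X) (cset_eq s 2 (cS_X X)).
  by case: solX => _ [[]].
apply: encodes_eqcard eqc _.
pose c0 : code := Node 0%R [::].
have sz2 l : size l == 2 -> l = [:: head c0 l; last c0 l] by case: l => [|a [|b []]].
apply: (encodes_map (h := fun l : seq code => (head c0 l, last c0 l)))
  _ _ (@encodes_forest (cS_X X) (fun k => k == 2) (@internal W) mu admu _).
- move=> l l' [_ _ _ /sz2 lE] [_ _ _ /sz2 lE'] [eh el].
  by rewrite lE lE' eh el.
- move=> [a b]; split=> [[[/= [va ia] [vb ib] ab] cab]|[l [sl vl tl] /eqP sz_l [<- <-]]].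
    exists [:: a; b] => //; split=> //=; first by rewrite cab.
      by move=> c; rewrite !inE => /orP[]/eqP->.
    by rewrite big_cons big_seq1.
  case: l sl vl tl sz_l => [|a' [|b' []]] //=; rewrite andbT => cab vl tl _.
  split=> //; split; [apply: vl | apply: vl |]; rewrite ?inE ?eqxx ?orbT //.
  by move: tl; rewrite big_cons big_seq1.
- by move=> nu rho E; apply/encodes_cS_X/(@admDl _ _ _ rho); rewrite E.
Qed.

(* The dissymmetry theorem: sending an edge whose sides [a > b] differ to the
   tree rooted at its end in [b] is a bijection onto the trees whose root is not
   their center. *)
Lemma dissymmetry mu (H : finType) : adm s mu ->
  encodes H (fun c => (code_of mu c /\ 1 < size (kids c)) /\ centered c) ->
  #|cT_S X (msz mu)| + #|cT_SS X (msz mu)| = #|H| + #|cT_StoS X (msz mu)|.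
Proof.
move=> admu encH.
have [G encG] := encodes_restrict (fun z : code * code => ~~ cord z.1 z.2) (encodes_cT_StoS admu).
have -> : #|cT_StoS X (msz mu)| = #|cT_SS X (msz mu)| + #|G|.
  rewrite -card_sum; apply: (encodes_card (encodes_cT_StoS admu)).
  apply: encodes_ext (encodes_sum _ (encodes_cT_SS admu) encG) => [z|z [_ +] [_ /negP]] //.
  split=> [[[]|[]] //|hz]; have [cz|cz] := boolP (cord z.1 z.2); by [left | right].
rewrite addnC addnCA; congr (_ + _); rewrite addnC -card_sum.
apply: (encodes_card (encodes_cT_S admu)).
have encG' : encodes G (fun c => (code_of mu c /\ 1 < size (kids c)) /\ ~~ centered c).
  apply: encodes_map (fun z : code * code => add z.2 z.1) _ _ encG.
    move=> [a b] [a' b'] [[/= [va ia] [vb ib] _] ab] [[/= [va' ia'] [vb' ib'] _] ab'] eq_add.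
    have := bigkid_add va vb ia ab; rewrite eq_add bigkid_add // => -[eqa].
    by rewrite -(rest_add a vb) eq_add eqa rest_add.
  move=> c; split=> [[[[vc cm] kc] ncc]|[[a b] [[/= [va ia] [vb ib] ab] nab] <-]].
    case E : (bigkid c) => [a|]; last by rewrite /centered E in ncc.
    have [ac /andP[ia nar]] := bigkidP E.
    exists (a, rest c a); last exact: add_rest.
    split=> //; split=> /=.
    - by split=> //; apply: valid_kid ac.
    (* The root has at least two kids, so one is left when [a] is removed: the other side of the
       edge is internal as well. *)
    - split; first exact: valid_rest.
      by rewrite /internal -size_eq0 /= size_rem // -lt0n -subn1 subn_gt0.
    - by rewrite addrC -tot_add add_rest.
  split; last by rewrite /centered bigkid_add.
  split; first by split; [apply: valid_add | rewrite tot_add addrC].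
  by rewrite size_kids_add ltnS lt0n size_eq0.
apply: encodes_ext (encodes_sum _ encG' encH) => [c|c [_ /negP] + [_]] //.
split=> [[[]|[]] //|hc]; have [cc|cc] := boolP (centered c); by [right | left].
Qed.

End Counting.

(** * Adjacency in a rose tree *)

Section TreeAdjacency.
Variable T : eqType.
Implicit Types (t c : rtree T) (s : seq (rtree T)) (a x y : T).

Fixpoint tadj t x y : bool :=
  let: Node a s := t in
  has (fun c => [|| (x == a) && (y == root c), (y == a) && (x == root c) | tadj c x y]) s.

Lemma tadjP a s x y : reflect
  (exists2 c, c \in s & [\/ x = a /\ y = root c, y = a /\ x = root c | tadj c x y])
  (tadj (Node a s) x y).
Proof.
apply: (iffP hasP) => -[c cs H]; exists c => //.
  by case/or3P: H => [/andP[/eqP-> /eqP->]|/andP[/eqP-> /eqP->]|h]; [apply: Or31|apply: Or32|apply: Or33].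
by apply/or3P; case: H => [[-> ->]|[-> ->]|h]; rewrite ?eqxx; [apply: Or31|apply: Or32|apply: Or33].
Qed.

Lemma tadj_sym t x y : tadj t x y = tadj t y x.
Proof.
elim/rtree_ind': t => a s IH /=; apply: eq_in_has => c cs.
by rewrite (IH c cs) orbCA orbA orbAC -orbA.
Qed.

Lemma tadj_nodes t x y : tadj t x y -> x \in nodes t /\ y \in nodes t.
Proof.
elim/rtree_ind': t => a s IH /tadjP[c cs [[-> ->]|[-> ->]|/(IH c cs) [xc yc]]].
- by split; [apply: mem_head | apply: mem_nodes_kid cs (root_nodes c)].
- by split; [apply: mem_nodes_kid cs (root_nodes c) | apply: mem_head].
- by split; apply: mem_nodes_kid cs _.
Qed.

Lemma perm_nodes_kids a s s' : perm_eq s s' -> perm_eq (nodes (Node a s)) (nodes (Node a s')).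
Proof. by move=> ss; rewrite perm_cons; apply/perm_flatten/perm_map. Qed.

Lemma tadj_perm_kids a s s' : perm_eq s s' -> tadj (Node a s) =2 tadj (Node a s').
Proof. by move=> /perm_has ss x y; apply: ss. Qed.

Lemma perm_nodes_reroot x y s q :
  perm_eq (nodes (Node x (Node y q :: s))) (nodes (Node y (Node x s :: q))).
Proof.
apply/seq.permP => p; rewrite /= !count_cat /= addnCA.
by congr (_ + (_ + _)); apply: addnC.
Qed.

(** Moving the root from [x] to its kid [y] reverses one edge only and leaves the unrooted tree
    alone. *)
Lemma tadj_reroot x y s q :
  tadj (Node x (Node y q :: s)) =2 tadj (Node y (Node x s :: q)).
Proof.
move=> u v /=; rewrite [(u == y) && (v == x)]andbC [(v == y) && (u == x)]andbC.
by case: ((u == x) && (v == y)); case: ((v == x) && (u == y)); rewrite //= orbC.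
Qed.

Section Uniq.
Variables (a : T) (s : seq (rtree T)).
Hypothesis ut : uniq (nodes (Node a s)).

Lemma uniq_kid c : c \in s -> uniq (nodes c).
Proof.
move: ut => /= /andP[_]; elim: s => //= d s' IH.
by rewrite cat_uniq inE => /and3P[ud _ us] /predU1P[-> //|]; apply: IH.
Qed.

Lemma root_notin_kid c : c \in s -> a \notin nodes c.
Proof.
move: ut => /= /andP[+ _] cs; apply: contra => ac.
by apply/flattenP; exists (nodes c) => //; apply: map_f.
Qed.

Lemma kid_inj c c' x : c \in s -> c' \in s -> x \in nodes c -> x \in nodes c' -> c = c'.
Proof.
move: ut => /= /andP[_]; elim: s => //= d s' IH.
rewrite cat_uniq !inE => /and3P[_ /hasPn nd us] cs cs' xc xc'.
have notd e : e \in s' -> x \in nodes e -> x \notin nodes d.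
  by move=> es xe; apply: nd; apply/flattenP; exists (nodes e) => //; apply: map_f.
case/predU1P: cs xc => [->|cs] xc; case/predU1P: cs' xc' => [->|cs'] xc' //.
- by rewrite (negPf (notd _ cs' xc')) in xc.
- by rewrite (negPf (notd _ cs xc)) in xc'.
- exact: IH.
Qed.

Lemma uniq_kids_roots : uniq (map (@root T) s).
Proof.
move: ut => /= /andP[_]; elim: s => //= d s' IH.
rewrite cat_uniq => /and3P[_ /hasPn nd us]; rewrite IH // andbT.
apply/mapP => -[e es rde]; suff : root e \notin nodes d by rewrite -rde root_nodes.
by apply: nd; apply/flattenP; exists (nodes e); rewrite ?map_f ?root_nodes.
Qed.

Lemma tadj_kid c x y : c \in s -> x \in nodes c -> y != a ->
  tadj (Node a s) x y = tadj c x y.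
Proof.
move=> cs xc ya; apply/tadjP/idP => [[d ds]|h]; last by exists c => //; apply: Or33.
case=> [[xa _]|[/eqP]|h]; rewrite ?(negPf ya) //.
  by rewrite xa (negPf (root_notin_kid cs)) in xc.
by have [xd _] := tadj_nodes h; rewrite (kid_inj cs ds xc xd).
Qed.

Lemma tadj_root y : tadj (Node a s) a y = (y \in map (@root T) s).
Proof.
apply/tadjP/mapP => [[c cs]|[c cs ->]]; last by exists c => //; apply: Or31.
case=> [[_ ->]|[_ ac]|/tadj_nodes[ac _]]; first by exists c.
  by have := root_notin_kid cs; rewrite ac root_nodes.
by rewrite (negPf (root_notin_kid cs)) in ac.
Qed.

End Uniq.

(** The search descends into the kid containing [x], which is unique when labels are distinct. The
    default, met at the root and outside the tree, is the root itself. *)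
Fixpoint par t x : T :=
  let: Node a s := t in
  foldr (fun c r => if x \in nodes c then (if x == root c then a else par c x) else r) a s.

Fixpoint dep t x : nat :=
  let: Node a s := t in foldr (fun c r => if x \in nodes c then (dep c x).+1 else r) 0 s.

Lemma foldr_kid (R : Type) a s c x (f : rtree T -> R) r0 :
  uniq (nodes (Node a s)) -> c \in s -> x \in nodes c ->
  foldr (fun c r => if x \in nodes c then f c else r) r0 s = f c.
Proof.
move=> ut cs xc; have : all (fun d => (x \in nodes d) ==> (d == c)) s.
  by apply/allP => d ds; apply/implyP => xd; rewrite (kid_inj ut ds cs xd xc).
elim: s cs {ut} => //= d s IH; rewrite inE => cs /andP[dc alls].
case: ifP dc => [_ /eqP -> //|xd _]; apply: IH => //.
by case/predU1P: cs => // cd; rewrite -cd xc in xd.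
Qed.

Lemma par_kid a s c x : uniq (nodes (Node a s)) -> c \in s -> x \in nodes c ->
  par (Node a s) x = if x == root c then a else par c x.
Proof. exact: foldr_kid. Qed.

Lemma dep_kid a s c x : uniq (nodes (Node a s)) -> c \in s -> x \in nodes c ->
  dep (Node a s) x = (dep c x).+1.
Proof. exact: foldr_kid. Qed.

Lemma dep_root t : uniq (nodes t) -> dep t (root t) = 0.
Proof.
case: t => a s ut /=; have : all (fun c => a \notin nodes c) s.
  by apply/allP => c; apply: root_notin_kid.
by elim: s {ut} => //= c s IH /andP[/negPf ->].
Qed.

Lemma parP t x : uniq (nodes t) -> x \in nodes t -> x != root t ->
  [/\ par t x \in nodes t, dep t x = (dep t (par t x)).+1 & tadj t x (par t x)].
Proof.
elim/rtree_ind': t => a s IH ut /nodes_kidP [->|[c cs xc]]; rewrite ?eqxx // => xa.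
rewrite (par_kid ut cs xc) (dep_kid ut cs xc); have uc := uniq_kid ut cs.
have [xr|xr] := eqVneq x (root c).
  split; first exact: mem_head.
    by rewrite (dep_root ut) xr dep_root.
  by rewrite tadj_sym (tadj_root ut) xr map_f.
have [pc dc adj_c] := IH c cs uc xc xr; split; first exact: mem_nodes_kid pc.
  by rewrite (dep_kid ut cs pc) dc.
rewrite (tadj_kid ut cs xc) //; apply: contraNneq (root_notin_kid ut cs) => <- //.
Qed.

Lemma tadj_par t x y : uniq (nodes t) -> tadj t x y ->
  (y = par t x /\ x != root t) \/ (x = par t y /\ y != root t).
Proof.
elim/rtree_ind': t => a s IH ut /tadjP[c cs H]; have rc := root_nodes c.
have ac := root_notin_kid ut cs; have uc := uniq_kid ut cs.
have neq z : z \in nodes c -> z != a by move=> zc; apply: contraNneq ac => <-.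
case: H => [[-> ->]|[-> ->]|adj_c].
- by right; rewrite (par_kid ut cs rc) eqxx neq.
- by left; rewrite (par_kid ut cs rc) eqxx neq.
have [xc yc] := tadj_nodes adj_c.
rewrite (par_kid ut cs xc) (par_kid ut cs yc) /= !neq //.
by case: (IH c cs uc adj_c) => -[-> /negPf ->]; [left | right].
Qed.

(** The kid rooted at a given neighbour of [a] is the component of that neighbour once [a] is
    removed, so it can be read off from the adjacency. The induction is on the depth: the path from
    [root c] down to [x] avoids [a]. *)
Lemma nodes_subset_kid a a' s s' c c' :
  uniq (nodes (Node a s)) -> uniq (nodes (Node a s')) ->
  tadj (Node a s) =2 tadj (Node a s') -> c \in s -> c' \in s' -> root c = root c' ->
  {subset nodes c <= nodes c'}.
Proof.
move=> ut ut' eq_adj cs cs' rcc x.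
have [n] := ubnP (dep c x); elim: n x => // n IH x /ltnSE-le_n xc.
have ac := root_notin_kid ut cs; have uc := uniq_kid ut cs.
have [->|xr] := eqVneq x (root c); first by rewrite rcc root_nodes.
have [pc dc adj_c] := parP uc xc xr.
have pc' : par c x \in nodes c' by apply: IH => //; rewrite -ltnS -dc ltnS.
have xa : x != a by apply: contraNneq ac => <-.
have : tadj (Node a s) (par c x) x by rewrite (tadj_kid ut cs pc) // tadj_sym.
by rewrite eq_adj (tadj_kid ut' cs' pc' xa) => /tadj_nodes[].
Qed.

End TreeAdjacency.

Lemma tadj_rmapP (T U : eqType) (f : T -> U) (t : rtree T) (u v : U) :
  tadj (rmap f t) u v <-> exists x y, [/\ tadj t x y, u = f x & v = f y].
Proof.
have rootE c : root (rmap f c) = f (root c) by case: c.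
elim/rtree_ind': t u v => a s IH u v; split.
  move=> /tadjP[_ /mapP[c cs ->] H].
  case: H => [[-> ->]|[-> ->]|/(IH c cs) [x [y [h -> ->]]]].
  - exists a, (root c); split; rewrite ?rootE //.
    by apply/tadjP; exists c => //; apply: Or31.
  - exists (root c), a; split; rewrite ?rootE //.
    by apply/tadjP; exists c => //; apply: Or32.
  - by exists x, y; split=> //; apply/tadjP; exists c => //; apply: Or33.
move=> [x [y [/tadjP[c cs H] -> ->]]]; apply/tadjP; exists (rmap f c); first exact: map_f.
case: H => [[-> ->]|[-> ->]|h]; rewrite rootE; [by apply: Or31|by apply: Or32|apply: Or33].
by apply/IH => //; exists x, y.
Qed.

(** * Codes of trees with weighted nodes *)

Section Canon.
Variable W : finType.
Local Notation code := (rtree {ffun W -> nat}).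
Implicit Types (c : code) (s : seq code).

Fixpoint canon c : code := let: Node m s := c in Node m (sort (@cord W) (map canon s)).

Lemma tot_canon c : tot (canon c) = tot c.
Proof.
elim/rtree_ind': c => m s IH; rewrite /= !tot_node (perm_big _ (permEl (perm_sort _ _))).
rewrite big_map big_seq [in RHS]big_seq; congr (_ + _)%R.
by apply: eq_bigr => c cs; apply: IH.
Qed.

Lemma valid_canon c : all (fun m => m != 0%R) (nodes c) -> valid (canon c).
Proof.
elim/rtree_ind': c => m s IH /= /andP[-> /allP all_s].
rewrite (sort_sorted (@cord_total W)); apply/allP => c.
rewrite mem_sort => /mapP[d ds ->]; apply: IH => //; apply/allP => p pd.
by apply: all_s; apply/flattenP; exists (nodes d) => //; apply: map_f.
Qed.

Lemma canon_id c : valid c -> canon c = c.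
Proof.
elim/rtree_ind': c => m s IH /= /and3P[_ ss /allP vs]; congr Node.
rewrite (_ : map canon s = s) ?sort_cord_id //; apply: map_id_in => c cs.
by apply: IH => //; apply: vs.
Qed.

Lemma size_kids_canon c : size (kids (canon c)) = size (kids c).
Proof. by case: c => m s; rewrite size_sort size_map. Qed.

Lemma canon_cons m c s : canon (Node m (c :: s)) = add (canon (Node m s)) (canon c).
Proof.
congr Node; apply/sort_cordP => /=; rewrite perm_cons.
by rewrite perm_sym; apply: permEl; apply: perm_sort.
Qed.

End Canon.

(** * Independence of the normal form from the chosen root *)

Section TreeCode.
Variables (W : finType) (T : eqType) (wt : T -> {ffun W -> nat}).
Implicit Types (t c : rtree T) (s : seq (rtree T)).

Definition tcode t := canon (rmap wt t).

Lemma tcode_node a s : tcode (Node a s) = Node (wt a) (sort (@cord W) (map tcode s)).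
Proof. by rewrite /tcode /= -map_comp. Qed.

Lemma tcode_perm_kids a s s' : perm_eq s s' -> tcode (Node a s) = tcode (Node a s').
Proof.
by move=> ss; rewrite !tcode_node; congr Node; apply/sort_cordP/perm_map.
Qed.

Lemma tcode_cons a c s : tcode (Node a (c :: s)) = add (tcode (Node a s)) (tcode c).
Proof. exact: canon_cons. Qed.

Lemma size_kids_tcode t : size (kids (tcode t)) = size (kids t).
Proof. by rewrite size_kids_canon; case: t => a s; rewrite /= size_map. Qed.

Lemma tot_tcode t : tot (tcode t) = (\sum_(x <- nodes t) wt x)%R.
Proof. by rewrite tot_canon /tot nodes_rmap big_map. Qed.

Lemma valid_tcode t : {in nodes t, forall x, wt x != 0%R} -> valid (tcode t).
Proof.
by move=> wt0; apply: valid_canon; rewrite nodes_rmap all_map; apply/allP => x /wt0.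
Qed.

(** Nonempty [s] and [q] say that both ends of the edge carry internal sides, as [nf_add]
    requires. *)
Lemma nf_tcode_reroot x y s q :
  {in nodes (Node x (Node y q :: s)), forall z, wt z != 0%R} ->
  s != [::] -> q != [::] ->
  nf (tcode (Node x (Node y q :: s))) = nf (tcode (Node y (Node x s :: q))).
Proof.
move=> wt0 s0 q0; rewrite !tcode_cons.
have intl z r : r != [::] -> internal (tcode (Node z r)).
  by rewrite /internal -!size_eq0 size_kids_tcode.
apply: nf_add; rewrite ?intl //; apply: valid_tcode => z zt; apply: wt0.
  by move: zt; rewrite !inE => /predU1P[->|zt]; rewrite ?eqxx //= mem_cat zt !orbT.
exact: mem_nodes_kid (mem_head (Node y q) s) zt.
Qed.

(** Once the root is fixed, adjacency determines the rooted tree: kids correspond through their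
    roots, the neighbours of [a], and corresponding kids inherit equal adjacencies. *)
Lemma tcode_rooted_eq t t' : uniq (nodes t) -> uniq (nodes t') -> root t = root t' ->
  tadj t =2 tadj t' -> tcode t = tcode t'.
Proof.
elim/rtree_ind': t t' => a s IH [a' s'] ut ut' aa eq_adj.
have {}aa : a = a' by []; subst a'.
have eq_code c c' : c \in s -> c' \in s' -> root c = root c' -> tcode c = tcode c'.
  move=> cs cs' rcc.
  have sub := nodes_subset_kid a ut ut' eq_adj cs cs' rcc.
  have sub' := nodes_subset_kid a ut' ut (fun x y => esym (eq_adj x y)) cs' cs (esym rcc).
  apply: IH => //; [exact: uniq_kid ut _ cs | exact: uniq_kid ut' _ cs' |].
  move=> x y; apply/idP/idP => h; have [xc yc] := tadj_nodes h.
    have ya : y != a by apply: contraNneq (root_notin_kid ut cs) => <-.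
    by rewrite -(tadj_kid ut' cs' (sub _ xc) ya) -eq_adj (tadj_kid ut cs).
  have ya : y != a by apply: contraNneq (root_notin_kid ut' cs') => <-.
  by rewrite -(tadj_kid ut cs (sub' _ xc) ya) eq_adj (tadj_kid ut' cs').
rewrite !tcode_node; congr Node; apply/sort_cordP.
have eq_roots : map (@root T) s =i map (@root T) s'.
  by move=> y; rewrite -(tadj_root ut) eq_adj (tadj_root ut').
have perm_roots : perm_eq (map (@root T) s) (map (@root T) s').
  by apply: uniq_perm; [exact: uniq_kids_roots ut | exact: uniq_kids_roots ut' |].
(* The code of a kid as a function of its root, well defined since roots of kids are distinct. Both
   lists of codes are then images under [F] of lists of roots that are permutations of each
   other. *)
pose F r := tcode (head (Node a [::]) [seq c <- s | root c == r]).
have FE c : c \in s -> F (root c) = tcode c.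
  move=> cs; rewrite /F; congr tcode.
  have : c \in [seq d <- s | root d == root c] by rewrite mem_filter eqxx.
  case E : filter => [//|d l] _ /=.
  have : d \in [seq d <- s | root d == root c] by rewrite E mem_head.
  rewrite mem_filter => /andP[/eqP rdc ds]; apply: (kid_inj ut ds cs (root_nodes d)).
  by rewrite rdc root_nodes.
have -> : map tcode s = map F (map (@root T) s).
  by rewrite -map_comp; apply/eq_in_map => c cs; rewrite /= FE.
have -> : map tcode s' = map F (map (@root T) s').
  rewrite -map_comp; apply/eq_in_map => c' cs' /=.
  have : root c' \in map (@root T) s by rewrite eq_roots map_f.
  by case/mapP => c cs rcc; rewrite rcc FE // (eq_code c c').
exact: perm_map.
Qed.

(** The root travels to [y] one edge at a time. Every node it visits is internal: [y] has two
    neighbours, and an earlier node has the side it comes from and the kid it goes to. So each move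
    preserves [nf]. *)
Lemma move_root_kid c y : y \in nodes c -> forall x s, s != [::] ->
  uniq (nodes (Node x (c :: s))) ->
  {in nodes (Node x (c :: s)), forall z, wt z != 0%R} ->
  (exists u v, [/\ u != v, tadj (Node x (c :: s)) y u & tadj (Node x (c :: s)) y v]) ->
  exists t, [/\ root t = y, perm_eq (nodes t) (nodes (Node x (c :: s))),
    tadj t =2 tadj (Node x (c :: s)) & nf (tcode t) = nf (tcode (Node x (c :: s)))].
Proof.
elim/rtree_ind': c => z q IH yc x s s0 ut wt0 [u [v [uv yu yv]]].
have q0 : q != [::].
  apply: contra_neq uv => q0; move: yc; rewrite q0 /= mem_seq1 => /eqP yz.
  have only w : tadj (Node x (Node z q :: s)) y w -> w = x.
    have zs := mem_head (Node z q) s.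
    apply: contraTeq => wx; rewrite (tadj_kid ut zs) ?yz ?mem_head //.
    by rewrite q0.
  by rewrite (only u yu) (only v yv).
have pn := perm_nodes_reroot x z s q; have ta := tadj_reroot x z s q.
have nr := nf_tcode_reroot wt0 s0 q0.
case/nodes_kidP: yc => [->|[d dq yd]].
  by exists (Node z (Node x s :: q)); split=> //; rewrite perm_sym.
(* The siblings of the next kid [d] at the new root [z]; the old root side is among them, so the
   list is nonempty again. *)
pose q' := Node x s :: rem d q.
have pq : perm_eq (Node x s :: q) (d :: q').
  by apply/seq.permP => p /=; rewrite (seq.permP (perm_to_rem dq)) /= addnCA.
have pn' := perm_nodes_kids z pq; have ta' := tadj_perm_kids z pq.
have taE : tadj (Node z (d :: q')) =2 tadj (Node x (Node z q :: s)).
  by move=> v' w'; rewrite ta ta'.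
have pnE : perm_eq (nodes (Node z (d :: q'))) (nodes (Node x (Node z q :: s))).
  by rewrite perm_sym; apply: perm_trans pn pn'.
have [||w||t [rt pt tt nt]] := IH d dq yd z q'.
- by [].
- by rewrite (perm_uniq pnE).
- by rewrite (perm_mem pnE) => /wt0.
- by exists u, v; rewrite !taE.
exists t; split=> //; first exact: perm_trans pt pnE.
  by move=> v' w'; rewrite tt taE.
by rewrite nt nr (tcode_perm_kids z pq).
Qed.

(** Move the root of [t] to the root of [t'], which is internal as it has two kids; the trees then
    have the same root and the same adjacency. *)
Lemma nf_tcode_eq t t' : uniq (nodes t) -> uniq (nodes t') ->
  {in nodes t, forall z, wt z != 0%R} ->
  1 < size (kids t) -> 1 < size (kids t') ->
  nodes t =i nodes t' -> tadj t =2 tadj t' -> nf (tcode t) = nf (tcode t').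
Proof.
move=> ut ut' wt0 k2 k2' eq_nodes eq_adj.
have [eqr|neqr] := eqVneq (root t) (root t').
  by congr nf; apply: tcode_rooted_eq.
have : root t' \in nodes t by rewrite eq_nodes root_nodes.
case: t ut wt0 k2 eq_nodes eq_adj neqr => x s ut wt0 k2 eq_nodes eq_adj neqr.
case/nodes_kidP=> [r'x|[c cs r'c]]; first by rewrite r'x eqxx in neqr.
have pq := perm_to_rem cs; have pn := perm_nodes_kids x pq; have ta := tadj_perm_kids x pq.
have [||w||t1 [rt1 pt1 tt1 nt1]] := move_root_kid r'c (x := x) (s := rem c s).
- by rewrite -size_eq0 size_rem // -lt0n -subn1 subn_gt0.
- by rewrite -(perm_uniq pn).
- by rewrite -(perm_mem pn) => /wt0.
- case: t' ut' k2' {eq_nodes neqr r'c} eq_adj => a' [|d1 [|d2 s']] // ut' _ eq_adj.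
  exists (root d1), (root d2); rewrite -!ta !eq_adj !(tadj_root ut') !inE !eqxx orbT.
  split=> //; have := uniq_kids_roots ut'.
  by rewrite /= inE negb_or => /andP[/andP[]].
rewrite (tcode_perm_kids x pq) -nt1; congr nf; apply: tcode_rooted_eq => //.
  by rewrite (perm_uniq pt1) -(perm_uniq pn).
by move=> u v; rewrite tt1 -ta eq_adj.
Qed.

End TreeCode.

(** * Graphs represented by a tree of cliques *)

(** [d] is a height for which each vertex has at most one lower neighbour. At a highest vertex of a
    cycle both cycle neighbours are lower, hence equal, which a cycle of length at least three
    excludes. *)
Lemma no_cycle (T : finType) (G : sgraph T) (d : T -> nat) :
  (forall x y, adj G x y -> d x != d y) ->
  (forall x y z, adj G x y -> adj G x z -> d y < d x -> d z < d x -> y = z) ->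
  acyclic G.
Proof.
move=> dneq dpar c; rewrite leqNgt; case: c => [//|x0 c0] cyc; apply/negP => sz.
have adj_sym x y : adj G x y = adj G y x by rewrite /adj setUC.
case: (@arg_maxnP _ x0 (mem (x0 :: c0)) d (mem_head _ _)) => x xc xmax.
have [i q rot_c] := rot_to xc.
have : ucycle (adj G) (x :: q) by rewrite -rot_c rot_ucycle.
have qmax y : y \in q -> d y <= d x.
  move=> yq; have : y \in x0 :: c0 by rewrite -(mem_rot i) rot_c inE yq orbT.
  exact: xmax.
have : 2 < size (x :: q) by rewrite -rot_c size_rot.
case: q qmax {rot_c} => [|y q] // qmax; case/lastP: q qmax => // q z qmax _.
rewrite /ucycle /= rcons_path last_rcons => /andP[/and3P[xy _ zx]].
rewrite inE negb_or => /and3P[_ ynq _].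
have lt w : adj G x w -> w \in y :: rcons q z -> d w < d x.
  by move=> xw wq; rewrite ltn_neqAle eq_sym dneq // qmax.
have yz : y = z.
  rewrite adj_sym in zx; apply: (dpar x) => //; apply: lt => //.
    exact: mem_head.
  by rewrite inE mem_rcons mem_head orbT.
by rewrite yz mem_rcons mem_head in ynq.
Qed.

Section MakeGraph.
Variables (V : finType) (e : rel V).

Definition mk_edges : {set {set V}} :=
  [set E | [exists x, exists y, [&& x != y, e x y & E == [set x; y]]]].

Lemma mk_edges_pairs : [forall E in mk_edges, #|E| == 2].
Proof.
apply/forall_inP => E; rewrite inE => /existsP[x /existsP[y /and3P[xy _ /eqP ->]]].
by rewrite cards2 xy.
Qed.

Definition mk_graph := SGraph mk_edges_pairs.

Lemma adj_mk_graph x y : symmetric e -> adj mk_graph x y = (x != y) && e x y.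
Proof.
move=> e_sym; rewrite /adj inE.
apply/existsP/andP => [[u /existsP[v /and3P[uv euv /eqP xyuv]]]|[xy exy]]; last first.
  by exists x; apply/existsP; exists y; rewrite xy exy eqxx.
have xy : x != y.
  by move: (congr1 (fun E : {set V} => #|E|) xyuv); rewrite !cards2 uv; case: (x != y).
have : (u \in [set x; y]) && (v \in [set x; y]).
  by rewrite xyuv !inE !eqxx orbT.
rewrite !inE => /andP[/orP[]/eqP ux /orP[]/eqP vy]; split=> //.
- by rewrite ux vy eqxx in uv.
- by rewrite -ux -vy.
- by rewrite e_sym -ux -vy.
- by rewrite ux vy eqxx in uv.
Qed.

End MakeGraph.

Lemma sgraph_eqP (V : finType) (G H : sgraph V) : (adj G =2 adj H) -> G = H.
Proof.
move=> GH; apply: val_inj; apply/setP => E /=.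
have pair (K : sgraph V) F : F \in edges K -> exists x y, F = [set x; y].
  move=> FK; have /forall_inP/(_ F FK)/cards2P [x [y [_ ->]]] := edges_pairs K.
  by exists x, y.
by apply/idP/idP => EK; have [x [y EE]] := pair _ _ EK; move: (GH x y); rewrite /adj -EE EK.
Qed.

Lemma adj_irr (V : finType) (G : sgraph V) x : adj G x x = false.
Proof.
apply/negP => xx; have /forall_inP/(_ _ xx) := edges_pairs G.
by rewrite setUid cards1.
Qed.

Lemma adj_sym (V : finType) (G : sgraph V) : symmetric (adj G).
Proof. by move=> x y; rewrite /adj setUC. Qed.

(** [dist] is [#|V|] in the absence of walks, so a bound [k] says something about walks when it is
    below [#|V|]. *)
Lemma dist_leP (V : finType) (G : sgraph V) (x y : V) (k : nat) : k < #|V| ->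
  dist G x y <= k <-> exists2 p : seq V, size p <= k & path (adj G) x p /\ last x p = y.
Proof.
move=> kV; rewrite /dist.
set a := (fun k => _).
have aP m : reflect (exists2 p : seq V, size p = m & path (adj G) x p /\ last x p = y) (a m).
  apply: (iffP existsP) => [[p /andP[xp /eqP pl]]|[p sp [xp pl]]].
    by exists p; rewrite ?size_tuple.
  by exists (Tuple (introT eqP sp)); rewrite /= xp pl eqxx.
split=> [le_k|[p sp xp]].
  have lt : find a (iota 0 #|V|) < size (iota 0 #|V|) by rewrite size_iota (leq_ltn_trans le_k).
  have := nth_find 0 (etrans (has_find _ _) lt); rewrite nth_iota; last by rewrite size_iota in lt.
  by case/aP => p sp xp; exists p; rewrite ?sp.
rewrite leqNgt; apply/negP => /(leq_ltn_trans sp)/(before_find 0).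
rewrite nth_iota; last exact: leq_ltn_trans kV.
by move/aP; case; exists p.
Qed.

Section GraphRep.
Variable V : finType.
Implicit Types G H : sgraph V.

(* The nodes of [t] index a partition of the vertices into cliques, and two
   cliques are completely joined when their nodes are adjacent in [t]. *)
Definition clique_tree (N : finType) (t : rtree N) (f : V -> N) G : Prop :=
  [/\ uniq (nodes t), forall n, n \in nodes t <-> exists x, f x = n
    & forall x y, adj G x y = (x != y) && ((f x == f y) || tadj t (f x) (f y))].

Variables (N : finType) (t : rtree N) (f : V -> N) (G : sgraph V).
Hypothesis repG : clique_tree t f G.

Let ut : uniq (nodes t).
Proof. by case: repG. Qed.

Lemma mem_clique_tree x : f x \in nodes t.
Proof. by case: repG => _ fP _; apply/fP; exists x. Qed.

Lemma tadj_dep n m : tadj t n m -> dep t n = (dep t m).+1 \/ dep t m = (dep t n).+1.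
Proof.
move=> nm; have [nt mt] := tadj_nodes nm.
by case: (tadj_par ut nm) => -[-> r]; [left | right]; have [] := parP ut _ r.
Qed.

Lemma tadj_irr n : tadj t n n = false.
Proof. by apply/negP => /tadj_dep[] /eqP; rewrite ltn_eqF // ?(eq_sym _ _.+1) ltn_eqF. Qed.

Lemma par_lt n m : tadj t n m -> dep t m < dep t n -> m = par t n.
Proof.
move=> nm lt; case: (tadj_par ut nm) => -[// nE r].
have [_ mt] := tadj_nodes nm; have [_ dE _] := parP ut mt r.
by move: lt; rewrite dE -nE ltnNge leqnSn.
Qed.

Lemma root_connect_ind (P : N -> Prop) :
  P (root t) -> (forall n m, tadj t n m -> P n -> P m) -> forall n, n \in nodes t -> P n.
Proof.
move=> Pr Ps n; have [k] := ubnP (dep t n); elim: k n => // k IH n /ltnSE-le_k nt.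
have [->//|nr] := eqVneq n (root t); have [pt pd adj_p] := parP ut nt nr.
by apply: Ps (IH _ _ pt); rewrite ?(tadj_sym _ _ n) // -pd.
Qed.

Lemma clique_tree_connected : 0 < #|V| -> connected G.
Proof.
move=> V0; rewrite /connected V0.
have [_ fP adjG] := repG.
have [r fr] : exists r, f r = root t by apply/fP/root_nodes.
have conn : forall n, n \in nodes t -> forall x, f x = n -> connect (adj G) r x.
  apply: root_connect_ind => [x fx|n m nm IH x fx].
    have [->|rx] := eqVneq r x; first exact: connect0.
    by apply: connect1; rewrite adjG rx fr fx eqxx.
  have [y fy] : exists y, f y = n by apply/fP; case: (tadj_nodes nm).
  apply: connect_trans (IH y fy) _; apply: connect1; rewrite adjG fy fx nm orbT andbT.
  by apply: contraTneq nm => yx; rewrite -fy -fx yx tadj_irr.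
apply/forallP => x; apply/forallP => y.
have cs : connect_sym (adj G) by apply: sym_connect_sym; apply: adj_sym.
apply: (connect_trans (y := r)); last exact: conn (mem_clique_tree y) _ erefl.
by rewrite cs; apply: conn (mem_clique_tree x) _ erefl.
Qed.

(** The leaf root hangs each vertex [x] as a leaf at the node [f x]: two leaves are at distance 2 in
    the same clique and at distance 3 in adjacent cliques. *)
Definition root_node : finType := ({n | n \in nodes t} + V)%type.

Definition root_rel (u v : root_node) : bool :=
  match u, v with
  | inl n, inl m => tadj t (val n) (val m)
  | inl n, inr x | inr x, inl n => f x == val n
  | inr _, inr _ => false
  end.

Lemma root_rel_sym : symmetric root_rel.
Proof. by move=> [n|x] [m|y] //=; rewrite tadj_sym. Qed.

Definition leaf_root := mk_graph root_rel.

Lemma adj_leaf_root u v : adj leaf_root u v = root_rel u v.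
Proof.
rewrite adj_mk_graph; last exact: root_rel_sym.
by case: eqP => //= <-; case: u => //= n; rewrite tadj_irr.
Qed.

Definition fnode x : root_node := inl (exist _ (f x) (mem_clique_tree x)).

Lemma adj_leaf x v : adj leaf_root (inr x) v = (v == fnode x).
Proof.
rewrite adj_leaf_root; case: v => [n|y] //=.
by apply/eqP/eqP => [fx|[->]] //; congr inl; apply: val_inj.
Qed.

Lemma leaf_root_acyclic : acyclic leaf_root.
Proof.
pose d (u : root_node) := match u with inl n => dep t (val n) | inr x => (dep t (f x)).+1 end.
have dE u v : adj leaf_root u v -> d u = (d v).+1 \/ d v = (d u).+1.
  rewrite adj_leaf_root; case: u v => [n|x] [m|y] //=; first exact: tadj_dep.
    by move/eqP=> ->; right.
  by move/eqP=> ->; left.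
apply: (no_cycle (d := d)) => [u v /dE[] ->|u v w]; first by rewrite gtn_eqF.
  by rewrite ltn_eqF.
rewrite !adj_leaf_root; case: u => [n|x] /=; last first.
  by case: v w => [m|y] [k|z] //= /eqP fm /eqP fk _ _; congr inl; apply: val_inj; rewrite /= -fm -fk.
case: v w => [m|y] [k|z] //=.
- move=> nm nk dm dk; congr inl; apply: val_inj.
  by rewrite /= (par_lt nm dm) (par_lt nk dk).
- by move=> _ /eqP -> _; rewrite ltnNge leqnSn.
- by move=> /eqP -> _; rewrite ltnNge leqnSn.
- by move=> /eqP -> _; rewrite ltnNge leqnSn.
Qed.

Lemma leaf_root_connected : connected leaf_root.
Proof.
pose r : root_node := inl (exist _ (root t) (root_nodes t)).
have conn n : n \in nodes t -> forall h : n \in nodes t, connect (adj leaf_root) r (inl (exist _ n h)).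
  move: n; apply: root_connect_ind => [h|n m nm IH h].
    have -> // : exist (fun n => n \in nodes t) _ h = exist (fun n => n \in nodes t) _ (root_nodes t).
    exact: val_inj.
  have [nt _] := tadj_nodes nm; apply: connect_trans (IH nt) _; apply: connect1.
  by rewrite adj_leaf_root.
have conn' u : connect (adj leaf_root) r u.
  case: u => [[n h]|x]; first exact: conn.
  apply: connect_trans (conn _ (mem_clique_tree x) (mem_clique_tree x)) _.
  by apply: connect1; rewrite adj_leaf_root /=.
have cs : connect_sym (adj leaf_root) by apply: sym_connect_sym; apply: adj_sym.
apply/andP; split; first by apply/card_gt0P; exists r.
by apply/forallP => u; apply/forallP => v; apply: connect_trans (conn' v); rewrite cs.
Qed.

(** The point to check is that no node of [t] becomes a leaf. It carries a vertex, and it has a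
    neighbour in [t] or is the only node, in which case it carries all vertices. *)
Lemma clique_tree_3LP : 2 < #|V| -> is_3LP G.
Proof.
move=> V3; have [_ fP adjG] := repG.
rewrite /is_3LP clique_tree_connected ?(leq_trans _ V3) //; apply/asboolP.
exists root_node, leaf_root, inr; split.
- by split; [apply: leaf_root_connected | apply: leaf_root_acyclic].
- by move=> x y [].
- have deg_leaf x : degree leaf_root (inr x) = 1.
    rewrite /degree (_ : [set _ | _] = [set fnode x]) ?cards1 //.
    by apply/setP => v; rewrite !inE adj_leaf.
  have deg2 n v w : v != w -> adj leaf_root (inl n) v -> adj leaf_root (inl n) w ->
      degree leaf_root (inl n) != 1.
    move=> vw nv nw; rewrite neq_ltn; apply/orP; right.
    rewrite /degree (cardsD1 v) inE nv (cardsD1 w) !inE nw eq_sym vw.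
    by rewrite addnA addn1.
  move=> [n|x]; last by split=> // _; exists x.
  split=> [[x //]|deg1]; exfalso; suff : degree leaf_root (inl n) != 1 by rewrite deg1.
  have [x fx] : exists x, f x = val n by apply/fP/(valP n).
  have nx : adj leaf_root (inl n) (inr x) by rewrite adj_leaf_root /= fx.
  have [[m nm]|no_adj] := EM (exists m, tadj t (val n) m).
    have [_ mt] := tadj_nodes nm.
    apply: (deg2 n (inr x) (inl (exist _ m mt))) => //.
    by rewrite adj_leaf_root.
  have [y yx] : exists y, y != x.
    have : 0 < #|[set~ x]| by rewrite cardsC1 -subn1 subn_gt0 (leq_trans _ V3).
    by case/card_gt0P => y; rewrite !inE => ?; exists y.
  apply: (deg2 n (inr x) (inr y)) => //; first by apply: contra_neq yx => -[->].
  rewrite adj_leaf_root /= -fx; suff -> : f y = f x by [].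
  have nr : val n = root t.
    apply: contra_notP no_adj => /eqP nr; exists (par t (val n)).
    by case: (parP ut (valP n) nr).
  rewrite fx nr; apply: contra_notP no_adj => /eqP yr.
  rewrite nr; case tE : t => [a s].
  have := mem_clique_tree y; rewrite tE => /nodes_kidP[yE|[c cs _]].
    by rewrite yE tE eqxx in yr.
  by exists (root c); apply/tadjP; exists c => //; apply: Or31.
- move=> x y xy; rewrite dist_leP; last first.
    have /card_gt0P : exists n, n \in {: {n | n \in nodes t}}.
      by exists (exist (fun n => n \in nodes t) (root t) (root_nodes t)).
    by move=> pos; rewrite card_sum; apply: leq_ltn_trans V3 _; rewrite -[ltnLHS]add0n ltn_add2r.
  rewrite adjG xy /=; split.
    case/orP=> [/eqP fxy|adj_xy].
      exists [:: fnode x; inr y] => //; split=> //=; rewrite adj_leaf eqxx andbT.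
      by rewrite adj_leaf_root /= fxy.
    exists [:: fnode x; fnode y; inr y] => //; split=> //=.
    by rewrite adj_leaf eqxx !adj_leaf_root /= adj_xy eqxx.
  case=> -[|u [|v [|w []]]] //= _ [].
  + by move=> _ [xy']; rewrite xy' eqxx in xy.
  + by rewrite adj_leaf => /andP[/eqP -> _].
  + by rewrite adj_leaf => /and3P[/eqP -> + _] vy; rewrite vy adj_leaf_root /= eq_sym => ->.
  + rewrite adj_leaf => /and4P[/eqP -> + + _] wy; rewrite wy.
    rewrite (adj_sym _ v) adj_leaf => + /eqP vE; rewrite vE adj_leaf_root /= => ->.
    by rewrite orbT.
Qed.

End GraphRep.

(** * Connected 3-leaf powers are represented by trees of cliques *)

Lemma attach_leaf (T : eqType) (t : rtree T) (u v : T) : u \in nodes t ->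
  exists t' : rtree T, [/\ root t' = root t, perm_eq (nodes t') (v :: nodes t)
    & forall x y, tadj t' x y -> [\/ tadj t x y, x = u /\ y = v | x = v /\ y = u]].
Proof.
elim/rtree_ind': t => a s IH /nodes_kidP[->|[c cs uc]].
  exists (Node a (Node v [::] :: s)); split=> //= [|x y].
    exact: permEl (perm_catCA [:: a] [:: v] _).
  case/orP => [/or3P[/andP[/eqP-> /eqP->]|/andP[/eqP-> /eqP->]|//]|h].
  - exact: Or32.
  - exact: Or33.
  - exact: Or31.
have [c' [rc' pc' ac']] := IH c cs uc.
have ps := perm_to_rem cs.
exists (Node a (c' :: rem c s)); split=> //= [|x y].
  have p1 := perm_nodes_kids a ps.
  rewrite -(perm_cons v) in p1; apply: perm_trans _ _; last by rewrite perm_sym; exact: p1.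
  apply: perm_trans (permEl (perm_catCA [:: a] [:: v] _)).
  by rewrite /= perm_cons -cat_cons perm_cat2r.
case/orP => [/or3P[/andP[/eqP-> /eqP->]|/andP[/eqP-> /eqP->]|/ac'[h|xy|xy]]|h].
- by apply: Or31; apply/tadjP; exists c => //; apply: Or31; rewrite rc'.
- by apply: Or31; apply/tadjP; exists c => //; apply: Or32; rewrite rc'.
- by apply: Or31; apply/tadjP; exists c => //; apply: Or33.
- exact: Or32.
- exact: Or33.
- have : tadj (Node a s) x y by rewrite (tadj_perm_kids a ps) /= h orbT.
  exact: Or31.
Qed.

(** * Connected vertex sets of an acyclic graph as rose trees *)

Section SpanningTree.
Variables (N : finType) (G : sgraph N) (S : {set N}) (r : N).
Let eS : rel N := fun x y => [&& x \in S, y \in S & adj G x y].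
Hypotheses (rS : r \in S) (connS : {in S, forall x, connect eS r x}).

Let subtree k (t : rtree N) :=
  [/\ uniq (nodes t), {subset nodes t <= S}, root t = r, size (nodes t) = k.+1
    & forall x y, tadj t x y -> adj G x y].

(** The tree grows by one leaf at a time. If no edge left its node set inside [S], that set would be
    closed under [eS] and would contain all of [S]. *)
Lemma subtree_exists k : k < #|S| -> exists t, subtree k t.
Proof.
elim: k => [|k IH] kS.
  by exists (Node r [::]); split=> //= x; rewrite mem_seq1 => /eqP ->.
have [t [ut tS rt st at_]] := IH (ltnW kS).
have [u [v [ut' vS vnt uv]]] : exists u v, [/\ u \in nodes t, v \in S, v \notin nodes t & adj G u v].
  apply: contrapT => no.
  have cl : closed eS (mem (nodes t)).
    move=> x y /and3P[xS yS xy]; apply/idP/idP => h; apply: contrapT => /negP nh.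
      by case: no; exists x, y.
    by case: no; exists y, x; rewrite adj_sym.
  have : S \subset nodes t.
    apply/subsetP => x /connS rx; rewrite -(closed_connect cl rx).
    by rewrite -rt; apply: root_nodes.
  move/subset_leq_card; rewrite (card_uniqP ut) st leqNgt kS //.
have [t' [rt' pt' at']] := attach_leaf v ut'.
exists t'; split.
- by rewrite (perm_uniq pt') /= vnt.
- by move=> x; rewrite (perm_mem pt') inE => /predU1P[-> //|/tS].
- by rewrite rt'.
- by rewrite (perm_size pt') /= st.
- by move=> x y /at'[/at_ //|[-> ->] //|[-> ->]]; rewrite adj_sym.
Qed.

(** An edge of [G] inside [S] closes the tree path between its ends to a cycle. By acyclicity this
    cycle has at most two items, so the path is the edge itself. *)
Lemma spanning_tree : acyclic G -> exists t : rtree N,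
  [/\ uniq (nodes t), nodes t =i S & {in S &, forall x y, tadj t x y = adj G x y}].
Proof.
move=> acG; have S_gt0 : 0 < #|S| by apply/card_gt0P; exists r.
have [t [ut tS rt st at_]] := subtree_exists (k := #|S|.-1) (eq_leq (prednK S_gt0)).
rewrite prednK // in st.
have tSE : nodes t =i S.
  have tS' : {subset nodes t <= enum S} by move=> x /tS; rewrite mem_enum.
  have := uniq_min_size ut tS'; rewrite -cardE -st => /(_ (leqnn _)) [_ h] x.
  by rewrite h mem_enum.
exists t; split=> // x y xS yS; apply/idP/idP => [/at_ //|xy].
apply: contraT => nxy.
have conn z : z \in nodes t -> connect (tadj t) r z.
  have [n] := ubnP (dep t z); elim: n z => // n IH z /ltnSE-le_n zt.
  have [->|nr] := eqVneq z (root t); first by rewrite rt connect0.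
  have [pt pd adj_p] := parP ut zt nr.
  apply: connect_trans (IH _ _ pt) _; first by rewrite -pd.
  by apply: connect1; rewrite tadj_sym.
have cs : connect_sym (tadj t) by apply: sym_connect_sym; apply: tadj_sym.
have : connect (tadj t) x y.
  by apply: (connect_trans (y := r)); rewrite ?(cs x) conn // tSE.
case/connectP => p0 /shortenP[p pathp up _] ly.
have pathG : path (adj G) x p by apply: sub_path pathp.
have : ucycle (adj G) (x :: p).
  by rewrite /ucycle up andbT /= rcons_path pathG -ly adj_sym.
move/acG => /=; case: p {up} pathp pathG ly => [|z [|z' p]] //= pathp _ ly _.
  by rewrite ly adj_irr in xy.
by rewrite -ly andbT (negPf nxy) in pathp.
Qed.

End SpanningTree.

Lemma clique_tree_ext (V N : finType) (t t' : rtree N) (f : V -> N) (G : sgraph V) :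
  perm_eq (nodes t') (nodes t) -> tadj t' =2 tadj t ->
  clique_tree t f G -> clique_tree t' f G.
Proof.
move=> pt at_ [ut ft adjG]; split=> [|n|x y]; first by rewrite (perm_uniq pt).
  by rewrite (perm_mem pt).
by rewrite at_.
Qed.

(** A root with one kid is a leaf of the tree. If the kid has kids of its own, it becomes the root;
    otherwise the two nodes merge into a single clique. *)
Lemma clique_tree_reroot (V N : finType) (t : rtree N) (f : V -> N) (G : sgraph V) :
  clique_tree t f G ->
  exists (N' : finType) (t' : rtree N') (f' : V -> N'),
    clique_tree t' f' G /\ size (kids t') != 1.
Proof.
move=> repG; have [k1|] := eqVneq (size (kids t)) 1; last by exists N, t, f.
case: t k1 repG => x [|[y q] [|]] //= _ repG.
have [q0|q0] := eqVneq q [::].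
  exists unit, (Node tt [::]), (fun=> tt); split=> //.
  have [ut fP adjG] := repG.
  split=> // [[]|u v].
    by split=> // _; have [z _] : exists z, f z = x by [apply/fP; apply: mem_head]; exists z.
  rewrite adjG eqxx /= q0; case: eqP => //= _.
  have fxy z : (f z == x) || (f z == y).
    have : f z \in nodes (Node x [:: Node y q]) by apply/fP; exists z.
    by rewrite q0 /= !inE.
  rewrite orbF; case/orP: (fxy u) => /eqP ->; case/orP: (fxy v) => /eqP ->; by rewrite !eqxx ?orbT.
exists N, (Node y (Node x [::] :: q)), f; split; last by case: q q0 {repG}.
apply: clique_tree_ext repG; first by rewrite perm_sym; apply: perm_nodes_reroot.
by move=> u v; rewrite tadj_reroot.
Qed.

(** * From a leaf root to a tree of cliques *)

Section LeafRoot.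
Variables (V N : finType) (G : sgraph V) (T : sgraph N) (leaf : V -> N).
Hypotheses (V3 : 2 < #|V|) (lrT : is_leaf_root 3 G T leaf) (connG : connected G).

Let leaf_inj : injective leaf. Proof. by case: lrT. Qed.

Lemma leaf_parent : exists f : V -> N, forall x u, adj T (leaf x) u = (u == f x).
Proof.
have H x : exists n, forall u, adj T (leaf x) u = (u == n).
  case: lrT => _ _ leafP _; have /cards1P [n nE] : degree T (leaf x) == 1.
    by apply/eqP/leafP; exists x.
  by exists n => u; have := in_set1 u n; rewrite -nE inE.
by have [f fP] := choice H; exists f.
Qed.

Lemma connect_adj_ind (A : N -> Prop) x y :
  (forall u v, adj T u v -> A u -> A v) -> A x -> A y.
Proof.
move=> step Ax; case: lrT => -[/andP[_ /forallP/(_ x)/forallP/(_ y)/connectP[p pp ->]] _] _ _ _.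
by elim: p x Ax pp => //= z p IH x Ax /andP[xz]; apply: IH; apply: step xz Ax.
Qed.

Variable f : V -> N.
Hypothesis fP : forall x u, adj T (leaf x) u = (u == f x).

(** Two adjacent leaves make up a whole connected component, whereas [T] is connected with at least
    three leaves. *)
Lemma parent_not_leaf x y : f x != leaf y.
Proof.
apply/eqP => fxy; have lxy : adj T (leaf x) (leaf y) by rewrite fP fxy.
have fy : f y = leaf x by apply/eqP; rewrite eq_sym -fP adj_sym.
have two n : n = leaf x \/ n = leaf y.
  apply: (connect_adj_ind (x := leaf x) (A := fun n => n = leaf x \/ n = leaf y)); last by left.
  by move=> u v uv [] uE; move: uv; rewrite uE fP => /eqP ->; [right | left].
have /card_gt0P [z] : 0 < #|~: [set x; y]|.
  rewrite cardsCs setCK subn_gt0 (leq_trans _ V3) // ltnS cards2.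
  by case: (x != y).
rewrite !inE negb_or => /andP[zx zy].
by case: (two (leaf z)) => /leaf_inj E; rewrite E eqxx in zx zy.
Qed.

Lemma adj_leaf_power x y : adj G x y = (x != y) && ((f x == f y) || adj T (f x) (f y)).
Proof.
have [->|xy] := eqVneq x y; first by rewrite adj_irr.
have [_ _ _ /(_ x y xy) adjG] := lrT.
(* At least three leaves, and the neighbour [f x], which is no leaf: [dist_leP] applies with the
   bound 3. *)
have N4 : 3 < #|N|.
  pose h (o : option V) := if o is Some z then leaf z else f x.
  have hI : injective h.
    move=> [u|] [v|] //= => [/leaf_inj -> //|/esym/eqP|/eqP].
      by rewrite (negPf (parent_not_leaf _ _)).
    by rewrite (negPf (parent_not_leaf _ _)).
  by have := leq_card h hI; rewrite card_option; apply: leq_trans.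
have lfx z : adj T (leaf z) (f z) by rewrite fP.
have flx z : adj T (f z) (leaf z) by rewrite adj_sym fP.
apply/idP/idP => [/adjG|H].
  case/(dist_leP T _ _ N4) => -[|u [|v [|w []]]] //= _ [].
  - by move=> _ /leaf_inj E; rewrite E eqxx in xy.
  - by rewrite fP andbT => /eqP ux uy; have := parent_not_leaf x y; rewrite -ux uy eqxx.
  - rewrite fP => /and3P[/eqP -> + _] vy.
    by rewrite vy adj_sym fP => /eqP ->; rewrite eqxx.
  - rewrite fP => /and4P[/eqP -> + + _] wy.
    by rewrite wy (adj_sym _ v) fP => + /eqP vE; rewrite vE => ->; rewrite orbT.
apply/adjG/(dist_leP T _ _ N4); case/orP: H => [/eqP fxy|fxy].
  by exists [:: f x; leaf y] => //; split=> //=; rewrite lfx fxy flx.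
by exists [:: f x; f y; leaf y] => //; split=> //=; rewrite lfx fxy flx.
Qed.

(** Internal nodes of [T] to which no leaf is attached are discarded. The neighbours of leaves still
    induce a connected subgraph of [T], because adjacent vertices of the connected graph [G] have
    equal or adjacent ones. *)
Lemma leaf_root_clique_tree : exists t : rtree N, clique_tree t f G.
Proof.
have /card_gt0P [x0 _] : 0 < #|V| by apply: leq_trans V3.
pose S := [set f x | x in V].
have fS x : f x \in S by apply: imset_f.
pose eS : rel N := fun x y => [&& x \in S, y \in S & adj T x y].
have connS : {in S, forall n, connect eS (f x0) n}.
  move=> _ /imsetP[x _ ->].
  have /andP[_ /forallP/(_ x0)/forallP/(_ x)/connectP[p pp ->]] := connG.
  elim: p x0 pp => [|z p IH] u /= => [_|/andP[uz pz]]; first exact: connect0.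
  apply: connect_trans (IH z pz).
  move: uz; rewrite adj_leaf_power => /andP[_ /orP[/eqP ->|fuz]]; first exact: connect0.
  by apply: connect1; rewrite /eS !fS.
have acT : acyclic T by case: lrT => -[].
have [t [ut tS at_]] := spanning_tree (fS x0) connS acT.
exists t; split=> // [n|x y]; last by rewrite adj_leaf_power at_.
by rewrite tS; split=> [/imsetP[x _ ->]|[x <-]] //; exists x.
Qed.

End LeafRoot.

Lemma clique_tree_exists (V : finType) (G : sgraph V) : 2 < #|V| -> is_3LP G ->
  exists (N : finType) (t : rtree N) (f : V -> N),
    clique_tree t f G /\ size (kids t) != 1.
Proof.
move=> V3 /andP[cG /asboolP[N [T [leaf lrT]]]].
have [f fP] := leaf_parent lrT.
have [t rep] := leaf_root_clique_tree V3 lrT cG fP.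
exact: clique_tree_reroot rep.
Qed.

(** * The code of a graph *)

Lemma eq_in_rmap (T : eqType) (U : Type) (f g : T -> U) (t : rtree T) :
  {in nodes t, f =1 g} -> rmap f t = rmap g t.
Proof.
elim/rtree_ind': t => a s IH fg /=; congr Node; first by apply: fg; apply: mem_head.
apply/eq_in_map => c cs; apply: IH => // x xc; apply: fg; exact: mem_nodes_kid xc.
Qed.

Lemma tcode_rmap (W : finType) (T U : eqType) (wt : U -> {ffun W -> nat}) (f : T -> U)
  (t : rtree T) : tcode wt (rmap f t) = tcode (wt \o f) t.
Proof. by rewrite /tcode rmap_comp. Qed.

Lemma eq_in_tcode (W : finType) (T : eqType) (w w' : T -> {ffun W -> nat}) (t : rtree T) :
  {in nodes t, w =1 w'} -> tcode w t = tcode w' t.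
Proof. by move=> ww; rewrite /tcode (eq_in_rmap ww). Qed.

Lemma wI (W : finType) (m m' : {ffun W -> nat}) : (forall w, m w = m' w) -> m = m'.
Proof. by move=> mm; apply/ffunP. Qed.

Section Colored.
Variables (V W : finType) (k : V -> W).
Implicit Types (X Y : {set V}) (G H : sgraph V).

(** The color content of a clique: the clique itself when [k] is injective, its size when [k] is
    constant. *)
Definition wset X : {ffun W -> nat} := (\sum_(x in X) delta (k x))%R.

Lemma wsetE X w : wset X w = #|[set x in X | k x == w]|.
Proof.
rewrite w_sum -sum1_card big_mkcond [RHS]big_mkcond; apply: eq_bigr => x _.
by rewrite inE ffunE eq_sym; case: (x \in X) => //=; case: (_ == w).
Qed.

Lemma msz_wset X : msz (wset X) = #|X|.
Proof. by rewrite msz_sum -sum1_card; apply: eq_bigr => x _; rewrite msz_delta. Qed.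

Lemma wset_neq0 X x : x \in X -> wset X != 0%R.
Proof. by move=> xX; rewrite -msz_gt0 msz_wset; apply/card_gt0P; exists x. Qed.

(** Color by color, the elements of [X] and of [Y] are listed and those at equal positions are
    matched. *)
Lemma wset_bij X Y : wset X = wset Y -> exists g : V -> V,
  [/\ {in X &, injective g}, {in X, forall x, g x \in Y} & {in X, forall x, k (g x) = k x}].
Proof.
move=> XY.
pose X' w := enum [set x in X | k x == w]; pose Y' w := enum [set y in Y | k y == w].
have sz w : size (X' w) = size (Y' w) by rewrite -!cardE -!wsetE XY.
pose g x := nth x (Y' (k x)) (index x (X' (k x))).
have xX' x : x \in X -> x \in X' (k x) by rewrite mem_enum inE eqxx andbT.
have gY' x : x \in X -> g x \in Y' (k x).
  by move=> /xX' xX; apply: mem_nth; rewrite -sz index_mem.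
exists g; split=> [x y xX yX gxy|x /gY'|x /gY'].
- have kxy : k x = k y.
    have := gY' y yX; rewrite -gxy => gx; move: gx (gY' x xX).
    by rewrite !mem_enum !inE => /andP[_ /eqP <-] /andP[_ /eqP <-].
  have ix : index x (X' (k x)) < size (Y' (k x)) by rewrite -sz index_mem xX'.
  have iy : index y (X' (k x)) < size (Y' (k x)) by rewrite -sz kxy index_mem xX'.
  move/eqP: gxy; rewrite /g -kxy (set_nth_default x y iy).
  rewrite nth_uniq ?enum_uniq // => /eqP ixy.
  rewrite -(nth_index x (xX' x xX)) ixy nth_index //.
  by rewrite kxy xX'.
- by rewrite mem_enum inE => /andP[].
- by rewrite mem_enum inE => /andP[_ /eqP].
Qed.

(** [Y] takes [m w] elements of each color [w], of which [X] has enough. *)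
Lemma wset_split X (m p : {ffun W -> nat}) : wset X = (m + p)%R ->
  exists2 Y : {set V}, Y \subset X & wset Y = m /\ wset (X :\: Y) = p.
Proof.
move=> Xmp.
suff [Y YX Ym] : exists2 Y : {set V}, Y \subset X & wset Y = m.
  exists Y => //; split=> //; apply: (wIr (m := m)); rewrite -Xmp -Ym /wset.
  rewrite [in RHS](bigID (mem Y)) /=; congr (_ + _)%R; apply: eq_bigl => x.
    by have [xY|] := boolP (x \in Y); rewrite ?andbF // (subsetP YX).
  by rewrite inE andbC.
pose X' w := enum [set x in X | k x == w].
have mX w : m w <= size (X' w) by rewrite -cardE -wsetE Xmp wD leq_addr.
exists [set x in X | x \in take (m (k x)) (X' (k x))].
  by apply/subsetP => x; rewrite inE => /andP[].
apply: wI => w; rewrite wsetE.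
rewrite (_ : [set _ in _ | _] = [set x in take (m w) (X' w)]); last first.
  apply/setP => x; rewrite !inE; apply/andP/idP => [[/andP[_ h] /eqP <-] //|h].
  have := mem_take h; rewrite mem_enum inE => /andP[xX /eqP kx].
  by rewrite kx eqxx xX.
rewrite cardsE (card_uniqP _) ?take_uniq ?enum_uniq // size_takel //.
Qed.

Section Rep.
Variables (N : finType).
Implicit Types (t : rtree N) (f : V -> N).

Definition fiber f n := [set x | f x == n].

Definition gcode t f := tcode (wset \o fiber f) t.

Lemma fiber_neq0 t f G : clique_tree t f G ->
  {in nodes t, forall n, (wset \o fiber f) n != 0%R}.
Proof.
by move=> [_ fP _] n /fP[x <-]; apply: (@wset_neq0 _ x); rewrite inE.
Qed.

Lemma valid_gcode t f G : clique_tree t f G -> valid (gcode t f).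
Proof. by move=> /fiber_neq0; apply: valid_tcode. Qed.

Lemma tot_gcode t f G : clique_tree t f G -> tot (gcode t f) = wset setT.
Proof.
move=> [ut fP _]; rewrite tot_tcode; transitivity (\sum_x delta (k x))%R; last first.
  by apply: eq_bigl => x; rewrite inE.
rewrite (partition_big f (mem (nodes t))) /=; last by move=> x _; apply/fP; exists x.
rewrite big_uniq //=; apply: eq_bigr => n _.
by rewrite /wset; apply: eq_bigl => x; rewrite inE.
Qed.

Lemma clique_tree_move_root t f G c q (x y : N) : clique_tree (Node x (Node y q :: c)) f G ->
  clique_tree (Node y (Node x c :: q)) f G.
Proof.
apply: clique_tree_ext; first by rewrite perm_sym; apply: perm_nodes_reroot.
by move=> u v; rewrite tadj_reroot.
Qed.

(** The move of the root is carried out on the clique tree, towards a kid whose code is the big kid.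
    Thus the normal form is again the code of a tree representing [G]. *)
Lemma gcode_step t f G : clique_tree t f G ->
  exists t', clique_tree t' f G /\ gcode t' f = step (gcode t f).
Proof.
move=> rep; rewrite /step; case E : bigkid => [a|]; last by exists t.
have [ac _] := bigkidP E; have vt := valid_gcode rep.
case: t rep ac vt {E} => x s rep; rewrite /gcode => ac _.
have /mapP[c cs ca] : a \in map (tcode (wset \o fiber f)) s.
  by move: ac; rewrite tcode_node mem_sort.
have ps := perm_to_rem cs.
have {}rep : clique_tree (Node x (c :: rem c s)) f G.
  apply: clique_tree_ext rep; first by rewrite perm_sym; apply: perm_nodes_kids.
  by move=> u v; rewrite (tadj_perm_kids x ps).
rewrite (tcode_perm_kids _ x ps) tcode_cons.
case: c cs ca ps rep => y q cs ca ps rep.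
exists (Node y (Node x (rem (Node y q) s) :: q)); split; first exact: clique_tree_move_root rep.
rewrite tcode_cons ca rest_add //; apply: valid_tcode => n nt.
apply: (fiber_neq0 rep); move: nt => /=; rewrite !inE => /predU1P[->|nt].
  by rewrite eqxx.
by rewrite mem_cat nt !orbT.
Qed.

Lemma gcode_nf t f G : clique_tree t f G ->
  exists t', clique_tree t' f G /\ gcode t' f = nf (gcode t f).
Proof.
move=> rep; rewrite /nf; elim: (csz _) => [|n [t' [rep' E]]]; first by exists t.
have [t'' [rep'' E']] := gcode_step rep'.
by exists t''; rewrite E' E.
Qed.

(** Closed neighbourhoods: [x] and [y] are true twins when their rows agree. *)
Definition cadj G x y := (x == y) || adj G x y.

Section Twins.
Variables (t : rtree N) (f : V -> N) (G : sgraph V).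
Hypothesis rep : clique_tree t f G.

Lemma cadjE x y : cadj G x y = (f x == f y) || tadj t (f x) (f y).
Proof.
case: rep => _ _ adjG; rewrite /cadj adjG; case: eqP => //= ->.
by rewrite eqxx.
Qed.

(** Adjacent nodes have depths of opposite parity. *)
Lemma not_triangle n m l : tadj t n m -> tadj t m l -> tadj t n l = false.
Proof.
have d := tadj_dep rep; move=> /d nm /d ml; apply/negP => /d nl.
have ev i j : i = j.+1 \/ j = i.+1 -> odd i = ~~ odd j.
  by case=> ->; rewrite /= ?negbK.
by move: (ev _ _ nm) (ev _ _ ml) (ev _ _ nl) => -> ->; case: odd.
Qed.

(** Let [m] be the parent of [n]. Another neighbour of [m] exists, its own parent or, if [m] is the
    root, a second kid; it is not adjacent to [n], as this would give a triangle. *)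
Lemma distinguish n m : 1 < size (kids t) -> tadj t n m ->
  exists l, l \in nodes t /\ (((l == n) || tadj t n l) != ((l == m) || tadj t m l)).
Proof.
have ut : uniq (nodes t) by case: rep.
move=> k2 nm; wlog [nE nr] : n m nm / m = par t n /\ n != root t.
  move=> th; have [h|h] := tadj_par ut nm; first exact: th.
  by have [|l [lt l1]] := th m n _ h; [rewrite tadj_sym | exists l; rewrite eq_sym].
have [nt mt] := tadj_nodes nm.
have [_ dn _] := parP ut nt nr; rewrite -nE in dn.
suff [l ml ln] : exists2 l, tadj t m l & l != n.
  exists l; split; first by case: (tadj_nodes ml).
  rewrite ml orbT (negPf ln) (not_triangle nm ml) //.
have [mr|mr] := eqVneq m (root t); last first.
  have [_ dm adj_m] := parP ut mt mr; exists (par t m) => //.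
  by apply: contra_eq_neq dn => <-; rewrite dm; elim: dep.
have [l lk ln] : exists2 l, l \in map (@root N) (kids t) & l != n.
  have uk : uniq (map (@root N) (kids t)).
    by case: (t) ut => a s; apply: uniq_kids_roots.
  move: k2 uk; case: (kids t) => [|c1 [|c2 s]] //= _.
  rewrite inE negb_or => /andP[/andP[c12 _] _].
  have [e|ne] := eqVneq (root c1) n; last by exists (root c1); rewrite ?inE ?eqxx.
  by exists (root c2); rewrite ?inE ?eqxx ?orbT // -e eq_sym.
exists l => //; rewrite mr; case: (t) ut lk => a s ut' lk.
by rewrite (tadj_root ut').
Qed.

Lemma same_fiberP x y : 1 < size (kids t) ->
  f x = f y <-> (forall z, cadj G x z = cadj G y z).
Proof.
move=> k2; split=> [fxy z|h]; first by rewrite !cadjE fxy.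
apply/eqP/negPn/negP => fxy.
have : cadj G x y by rewrite h /cadj eqxx.
rewrite cadjE (negPf fxy) /= => /(distinguish k2) [l [lt]].
have [z <-] : exists z, f z = l by case: rep => _ fP _; apply/fP.
by rewrite ![f z == _]eq_sym -!cadjE h eqxx.
Qed.

Lemma tadj_fiberE x y : tadj t (f x) (f y) = (f x != f y) && cadj G x y.
Proof.
rewrite cadjE; case: eqP => [->|] //=; exact: tadj_irr rep _.
Qed.

Lemma kids0_complete : kids t = [::] -> forall x y, cadj G x y.
Proof.
move=> k0 x y; rewrite cadjE; apply/orP; left.
have [_ fP _] := rep; have root_only z : f z = root t.
  have := mem_clique_tree rep z; case: (t) k0 => a s /= ->.
  by rewrite mem_seq1 => /eqP.
by rewrite !root_only.
Qed.

Lemma not_complete : 1 < size (kids t) -> exists x y, ~~ cadj G x y.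
Proof.
move=> k2; have ut : uniq (nodes t) by case: rep.
have [n [m [nt mt nm nadj]]] : exists n m,
    [/\ n \in nodes t, m \in nodes t, n != m & ~~ tadj t n m].
  move: k2; case tE : t => [a [|c1 [|c2 s]]] // _.
  move: ut; rewrite tE => ut'.
  have adj1 : tadj t (root c1) a.
    by rewrite tE tadj_sym (tadj_root ut') mem_head.
  have adj2 : tadj t a (root c2).
    by rewrite tE (tadj_root ut') !inE eqxx orbT.
  exists (root c1), (root c2); rewrite -tE; split.
  - by case: (tadj_nodes adj1).
  - by case: (tadj_nodes adj2).
  - by have := uniq_kids_roots ut'; rewrite /= inE negb_or => /andP[/andP[]].
  - by rewrite (not_triangle adj1 adj2).
have [_ fP _] := rep; move/fP: nt => [x fx]; move/fP: mt => [y fy].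
by exists x, y; rewrite cadjE fx fy (negPf nm).
Qed.

End Twins.
End Rep.

(** Nodes are renamed by the cliques they stand for: trees over different index types become trees
    over sets of vertices and can be compared. *)
Lemma gcode_fiber (N : finType) (t : rtree N) (f : V -> N) :
  gcode t f = tcode wset (rmap (fiber f) t).
Proof. by rewrite tcode_rmap. Qed.

Lemma uniq_fiber_nodes (N : finType) (t : rtree N) (f : V -> N) G :
  clique_tree t f G -> uniq (nodes (rmap (fiber f) t)).
Proof.
move=> [ut fP _]; rewrite nodes_rmap map_inj_in_uniq // => n m /fP[x <-] _ eqf.
have : x \in fiber f (f x) by rewrite inE.
by rewrite eqf inE => /eqP.
Qed.

Lemma fiber_nodesP (N : finType) (t : rtree N) (f : V -> N) G X :
  clique_tree t f G -> X \in nodes (rmap (fiber f) t) <-> exists x, X = fiber f (f x).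
Proof.
move=> [ut fP _]; rewrite nodes_rmap; split=> [/mapP[n /fP[x <-] ->]|[x ->]]; first by exists x.
by apply: map_f; apply/fP; exists x.
Qed.

Lemma fiber_tadjP (N : finType) (t : rtree N) (f : V -> N) G X Y :
  clique_tree t f G -> tadj (rmap (fiber f) t) X Y <->
  exists x y, [/\ f x != f y, cadj G x y, X = fiber f (f x) & Y = fiber f (f y)].
Proof.
move=> rep; rewrite tadj_rmapP; split=> [[n [m [nm -> ->]]]|[x [y [fxy xy -> ->]]]].
  have [_ fP _] := rep; have [/fP[x fx] /fP[y fy]] := tadj_nodes nm.
  exists x, y; rewrite fx fy; split=> //.
    by apply: contraTneq nm => ->; rewrite (tadj_irr rep).
  by rewrite (cadjE rep) fx fy nm orbT.
by exists (f x), (f y); rewrite (tadj_fiberE rep) fxy xy.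
Qed.

(** One-node trees represent complete graphs, trees with two kids at the root do not, so both trees
    are of the same kind. In the second case nodes are the true twin classes and their adjacency
    comes from [G], so after renaming by fibers only the root can differ. *)
Lemma nf_gcode_eq (N N' : finType) (t : rtree N) (f : V -> N) (t' : rtree N') (f' : V -> N') G :
  clique_tree t f G -> clique_tree t' f' G ->
  size (kids t) != 1 -> size (kids t') != 1 ->
  nf (gcode t f) = nf (gcode t' f').
Proof.
move=> rep rep' k1 k1'.
have code0 (M : finType) (u : rtree M) g : clique_tree u g G -> kids u = [::] ->
    gcode u g = Node (wset setT) [::].
  case: u => a s repu /= s0; rewrite s0 in repu *.
  congr Node; congr wset; apply/setP => x; rewrite !inE.
  by have := mem_clique_tree repu x; rewrite /= mem_seq1.
have clash (M M' : finType) (u : rtree M) g (u' : rtree M') g' :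
    clique_tree u g G -> clique_tree u' g' G -> kids u = [::] -> 1 < size (kids u') -> False.
  move=> repu repu' u0 k2; have [x [y /negP[]]] := not_complete repu' k2.
  exact: kids0_complete repu u0 x y.
have kidsP (M : finType) (u : rtree M) : size (kids u) != 1 ->
    kids u = [::] \/ 1 < size (kids u).
  by case: (kids u) => [|c [|d s]]; [left | | right].
have [k0|k2] := kidsP _ _ k1; have [k0'|k2'] := kidsP _ _ k1'.
- by rewrite (code0 _ _ _ rep k0) (code0 _ _ _ rep' k0').
- by case: (clash _ _ _ _ _ _ rep rep' k0 k2').
- by case: (clash _ _ _ _ _ _ rep' rep k0' k2).
have eq_fiber x : fiber f (f x) = fiber f' (f' x).
  apply/setP => y; rewrite !inE; apply/eqP/eqP.
    by move/(same_fiberP rep _ _ k2)/(same_fiberP rep' _ _ k2').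
  by move/(same_fiberP rep' _ _ k2')/(same_fiberP rep _ _ k2).
have eq_f x y : (f x == f y) = (f' x == f' y).
  apply/eqP/eqP.
    by move/(same_fiberP rep _ _ k2)/(same_fiberP rep' _ _ k2').
  by move/(same_fiberP rep' _ _ k2')/(same_fiberP rep _ _ k2).
have size_kids_rmap (M : finType) (u : rtree M) (g : M -> {set V}) :
  size (kids (rmap g u)) = size (kids u) by case: u => a s; rewrite /= size_map.
rewrite !gcode_fiber; apply: nf_tcode_eq; rewrite ?size_kids_rmap //.
- exact: uniq_fiber_nodes rep.
- exact: uniq_fiber_nodes rep'.
- by move=> X /(fiber_nodesP _ rep)[x ->]; apply: (@wset_neq0 _ x); rewrite inE.
- move=> X; apply/idP/idP => [/(fiber_nodesP _ rep)[x ->]|/(fiber_nodesP _ rep')[x ->]].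
    by apply/(fiber_nodesP _ rep'); exists x; rewrite eq_fiber.
  by apply/(fiber_nodesP _ rep); exists x; rewrite eq_fiber.
- move=> X Y; apply/idP/idP.
    case/(fiber_tadjP _ _ rep) => x [y [fxy xy -> ->]].
    by apply/(fiber_tadjP _ _ rep'); exists x, y; rewrite -!eq_fiber -eq_f.
  case/(fiber_tadjP _ _ rep') => x [y [fxy xy -> ->]].
  by apply/(fiber_tadjP _ _ rep); exists x, y; rewrite !eq_fiber eq_f.
Qed.

End Colored.

(** * Codes classify graphs up to color-preserving isomorphism *)

(** Equal codes mean isomorphic trees. The isomorphism is recorded as a tree of pairs of matched
    nodes: its second projection is [t'] itself, its first is [t] up to the order of kids, hence the
    formulation by nodes and adjacency. *)
Lemma zip_trees (W : finType) (N N' : eqType) (w : N -> {ffun W -> nat})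
    (w' : N' -> {ffun W -> nat}) (t : rtree N) (t' : rtree N') :
  tcode w t = tcode w' t' -> exists z : rtree (N * N'),
    [/\ rmap snd z = t', perm_eq (map fst (nodes z)) (nodes t), (root z).1 = root t,
      tadj (rmap fst z) =2 tadj t & {in nodes z, forall p, w p.1 = w' p.2}].
Proof.
elim/rtree_ind': t t' => a s IH [a' s']; rewrite !tcode_node => -[waa /sort_cordP ss'].
suff [zs [zs' pz az wz]] : exists zs : seq (rtree (N * N')),
    [/\ map (rmap snd) zs = s',
      perm_eq (flatten (map (fun z => map fst (nodes z)) zs)) (flatten (map (@nodes _) s)),
      forall x y, tadj (Node a (map (rmap fst) zs)) x y = tadj (Node a s) x y
    & {in flatten (map (@nodes _) zs), forall p, w p.1 = w' p.2}].
  exists (Node (a, a') zs); split=> //=; first by rewrite zs'.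
    by rewrite perm_cons map_flatten -map_comp.
  by move=> p; rewrite inE => /predU1P[-> //|/wz].
elim: s' s IH ss' => [|c' s' IHs] s IH ss'.
  have s0 : s = [::] by case: s ss' {IH} => // c s /perm_size.
  by exists [::]; rewrite s0.
have : tcode w' c' \in map (tcode w) s by rewrite (perm_mem ss') mem_head.
case/mapP => c cs ecc; have ps := perm_to_rem cs.
have [z [ez pz rz az wz]] := IH c cs c' (esym ecc).
have [||zs [ezs pzs azs wzs]] := IHs (rem c s).
- by move=> d /mem_rem; apply: IH.
- rewrite -(perm_cons (tcode w' c')); apply: perm_trans ss'.
  by rewrite perm_sym ecc -map_cons; apply: perm_map.
exists (z :: zs); split=> /=.
- by rewrite ez ezs.
- apply: perm_trans (_ : perm_eq (nodes c ++ flatten (map (@nodes _) (rem c s))) _).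
    exact: perm_cat.
  rewrite perm_sym; exact: (perm_flatten (perm_map (@nodes _) ps)).
- move=> x y; have rE : root (rmap fst z) = root c by rewrite -rz; case: (z).
  rewrite -/(tadj (Node a s) x y) (tadj_perm_kids a ps) /= rE az; congr orb.
  exact: azs.
- by move=> p; rewrite mem_cat => /orP[/wz|/wzs].
Qed.

Section Classify.
Variables (V W : finType) (k : V -> W).
Implicit Types (X Y : {set V}) (G H : sgraph V).

(** Equality of graphs when [k] is injective, isomorphism when it is constant. *)
Definition color_iso G H : Prop :=
  exists2 s : {perm V}, forall x, k (s x) = k x & forall x y, adj G x y = adj H (s x) (s y).

(** Matched nodes are cliques with the same color content; the bijections between them given by
    [wset_bij] glue to a permutation of the vertices. *)
Lemma gcode_iso (N N' : finType) (t : rtree N) (f : V -> N) (t' : rtree N') (f' : V -> N') G H :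
  clique_tree t f G -> clique_tree t' f' H -> gcode k t f = gcode k t' f' -> color_iso G H.
Proof.
move=> rep rep' /zip_trees[z [ez pz _ az wz]].
have [ut fP adjG] := rep; have [ut' fP' adjH] := rep'.
have uz1 : uniq (map fst (nodes z)) by rewrite (perm_uniq pz).
have uz2 : uniq (map snd (nodes z)) by rewrite -nodes_rmap ez.
have inj1 := uniq_map_inj uz1; have inj2 := uniq_map_inj uz2.
have pfE x : exists2 p, p \in nodes z & p.1 = f x.
  have : f x \in map fst (nodes z) by rewrite (perm_mem pz); apply/fP; exists x.
  by case/mapP => p pz' ->; exists p.
pose pf x := s2val (cid2 (pfE x)).
have pfz x : pf x \in nodes z by rewrite /pf; case: cid2.
have pf1 x : (pf x).1 = f x by rewrite /pf; case: cid2.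
have gE p : exists g : V -> V, p \in nodes z ->
   [/\ {in fiber f p.1 &, injective g}, {in fiber f p.1, forall x, g x \in fiber f' p.2}
     & {in fiber f p.1, forall x, k (g x) = k x}].
  have [pz'|_] := boolP (p \in nodes z); last by exists id.
  by have [g gP] := wset_bij (wz p pz'); exists g.
have [g gP] := choice gE.
pose s x := g (pf x) x.
have xf x : x \in fiber f (pf x).1 by rewrite inE pf1.
have fs x : f' (s x) = (pf x).2.
  by have [_ h _] := gP _ (pfz x); have := h x (xf x); rewrite inE => /eqP.
have ks x : k (s x) = k x by have [_ _ h] := gP _ (pfz x); apply: h.
have sI : injective s.
  move=> x y sxy; have pxy : pf x = pf y by apply: inj2 => //; rewrite -!fs sxy.
  have [h _ _] := gP _ (pfz x); apply: h => //; first by rewrite pxy.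
  by rewrite {2}pxy.
exists (perm sI) => [x|x y]; rewrite !permE //.
rewrite adjG adjH (inj_eq sI) !fs -!pf1; congr (_ && (_ || _)).
  by apply/eqP/eqP => e; [congr snd; apply: inj1 | congr fst; apply: inj2].
rewrite -az -ez; apply/idP/idP => /tadj_rmapP[p [q [pq e1 e2]]];
  have [pz' qz'] := tadj_nodes pq.
  by rewrite (inj1 _ _ (pfz x) pz' e1) (inj1 _ _ (pfz y) qz' e2); apply/tadj_rmapP; exists p, q.
by rewrite (inj2 _ _ (pfz x) pz' e1) (inj2 _ _ (pfz y) qz' e2); apply/tadj_rmapP; exists p, q.
Qed.

Lemma clique_tree_iso (N : finType) (t : rtree N) (f : V -> N) G H :
  color_iso G H -> clique_tree t f G ->
  exists f', clique_tree t f' H /\ gcode k t f' = gcode k t f.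
Proof.
move=> [s ks adjGH] [ut fP adjG]; exists (fun x => f (s^-1%g x)); split.
  split=> // [n|x y]; last by rewrite -[in LHS](permKV s x) -[in LHS](permKV s y) -adjGH adjG (inj_eq perm_inj).
  rewrite fP; split=> -[x <-]; first by exists (s x); rewrite permK.
  by exists (s^-1%g x).
apply: eq_in_tcode => n _; rewrite /= /wset (reindex_inj (@perm_inj _ s)) /=.
by apply: eq_big => x; rewrite ?inE ?permK // ks.
Qed.

(** The set [X] is distributed over the nodes from the root downwards by [wset_split]. Counting the
    nodes that contain [x] expresses disjointness and covering at once and adds up along the
    recursion. *)
Lemma lift_code (c : rtree {ffun W -> nat}) X : tot c = wset k X ->
  exists t : rtree {set V}, rmap (wset k) t = c /\
    forall x, count (fun Y : {set V} => x \in Y) (nodes t) = (x \in X).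
Proof.
elim/rtree_ind': c X => m s IH X; rewrite tot_node => /esym/wset_split[Y YX [Ym Ys]].
suff [ts [tss cts]] : exists ts : seq (rtree {set V}), map (rmap (wset k)) ts = s /\
    forall x, count (fun Y : {set V} => x \in Y) (flatten (map (@nodes _) ts)) = (x \in X :\: Y).
  exists (Node Y ts); split=> [|x] /=; first by rewrite tss Ym.
  rewrite cts inE; have [xY|xY] := boolP (x \in Y); last by [].
  by rewrite (subsetP YX).
move: (X :\: Y) Ys => Z; elim: s IH Z {Ym} => [|c s IHs] IH Z.
  rewrite big_nil => /eqP; rewrite -msz_eq0 msz_wset cards_eq0 => /eqP ->.
  by exists [::]; split=> // x; rewrite inE.
rewrite big_cons => /wset_split[Z' ZZ [Zc Zs]].
have [t [tc ct]] := IH c (mem_head _ _) Z' (esym Zc).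
have [|ts [tss cts]] := IHs _ _ Zs; first by move=> d ds; apply: IH; rewrite inE ds orbT.
exists (t :: ts); split=> [|x] /=; first by rewrite tc tss.
rewrite count_cat ct cts inE; have [xZ|xZ] := boolP (x \in Z'); last by [].
by rewrite (subsetP ZZ).
Qed.

Lemma code_realized (c : rtree {ffun W -> nat}) : valid c -> tot c = wset k setT ->
  exists (G : sgraph V) (t : rtree {set V}) (f : V -> {set V}),
    [/\ clique_tree t f G, gcode k t f = c & size (kids t) = size (kids c)].
Proof.
move=> vc totc; have [t [tc ct]] := lift_code totc.
have neq0 : {in nodes t, forall Y, Y != set0}.
  have : all (fun m => m != 0%R) (nodes c).
    elim/rtree_ind': c vc {totc tc} => m s IH /= /and3P[-> _ /allP vs]; apply/allP => p.
    by case/flattenP => _ /mapP[d ds ->] pd; exact: (allP (IH d ds (vs d ds)) p pd).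
  rewrite -tc nodes_rmap all_map => /allP h Y /h /=; apply: contra_neq => ->.
  by rewrite /wset big_set0.
have ct1 x : count (fun Y : {set V} => x \in Y) (nodes t) = 1 by rewrite ct inE.
have [ut pt] := uniq_cover1 neq0 ct1.
(* The only node containing [x]; the default [set0] is never reached since each vertex is covered
   exactly once. *)
pose f x := head set0 [seq Y : {set V} <- nodes t | x \in Y].
have fP x Y : Y \in nodes t -> x \in Y -> f x = Y.
  move=> Yt xY; have := ct1 x; rewrite -size_filter /f.
  have : Y \in [seq Y : {set V} <- nodes t | x \in Y] by rewrite mem_filter xY.
  by case: filter => [|Z []] //; rewrite inE => /eqP ->.
have fx x : f x \in nodes t /\ x \in f x.
  have /hasP[Y Yt xY] : has (fun Y : {set V} => x \in Y) (nodes t) by rewrite has_count ct1.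
  by rewrite (fP x Y).
pose e : rel V := fun x y => (f x == f y) || tadj t (f x) (f y).
have e_sym : symmetric e by move=> x y; rewrite /e eq_sym tadj_sym.
exists (mk_graph e), t, f; split.
- split=> // [Y|x y]; last exact: adj_mk_graph.
  split=> [Yt|[x <-]]; last by case: (fx x).
  by have /set0Pn[x xY] := neq0 Y Yt; exists x; apply: fP.
- have vcE : canon c = c by apply: canon_id.
  rewrite -[RHS]vcE -tc; apply: eq_in_tcode => Y Yt /=; congr wset.
  apply/setP => x; rewrite inE; apply/eqP/idP => [<-|]; last exact: fP.
  by case: (fx x).
by rewrite -tc; case: (t) => a s; rewrite /= size_map.
Qed.

Definition has_code G (c : rtree {ffun W -> nat}) : Prop :=
  exists (N : finType) (t : rtree N) (f : V -> N),
    [/\ clique_tree t f G, size (kids t) != 1 & nf (gcode k t f) = c].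

Definition good_code (c : rtree {ffun W -> nat}) : Prop :=
  [/\ valid c, tot c = wset k setT, size (kids c) != 1 & centered c].

Lemma has_code_good G c : has_code G c -> good_code c.
Proof.
move=> [N [t [f [rep k1 <-]]]]; have vt := valid_gcode k rep; split.
- exact: nf_valid.
- by rewrite nf_tot // (tot_gcode _ rep).
- by apply: nf_kids => //; rewrite size_kids_tcode.
- exact: nf_centered.
Qed.

Lemma has_code_fun G c c' : has_code G c -> has_code G c' -> c = c'.
Proof.
move=> [N [t [f [rep k1 <-]]]] [N' [t' [f' [rep' k1' <-]]]].
exact: nf_gcode_eq rep rep' k1 k1'.
Qed.

Lemma has_code_iso G H c : color_iso G H -> has_code G c -> has_code H c.
Proof.
move=> GH [N [t [f [rep k1 <-]]]]; have [f' [rep' E]] := clique_tree_iso GH rep.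
by exists N, t, f'; rewrite E.
Qed.

Lemma has_code_inj G H c : has_code G c -> has_code H c -> color_iso G H.
Proof.
move=> [N [t [f [rep k1 E]]]] [N' [t' [f' [rep' k1' E']]]].
have [u [repu eu]] := gcode_nf k rep; have [u' [repu' eu']] := gcode_nf k rep'.
by apply: gcode_iso repu repu' _; rewrite eu eu' E.
Qed.

Lemma good_code_realized c : 2 < #|V| -> good_code c -> exists2 G, is_3LP G & has_code G c.
Proof.
move=> V3 [vc totc k1 cc]; have [G [t [f [rep E kc]]]] := code_realized vc totc.
exists G; first exact: clique_tree_3LP rep V3.
by exists _, t, f; rewrite kc E nf_id.
Qed.

Lemma is_3LP_code G : 2 < #|V| -> is_3LP G -> exists c, has_code G c.
Proof.
move=> V3 /(clique_tree_exists V3)[N [t [f [rep k1]]]].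
by exists (nf (gcode k t f)), N, t, f.
Qed.

End Classify.

(** * The labeled and the unlabeled setting *)

Lemma isomorphic_equiv (V : finType) : equivalence_rel (@isomorphic V).
Proof.
have symP (G H : sgraph V) : isomorphic G H -> isomorphic H G.
  move=> /existsP[s /forallP sP]; apply/existsP; exists (s^-1%g).
  apply/forallP => x; apply/forallP => y.
  by have /forallP/(_ (s^-1%g y))/eqP := sP (s^-1%g x); rewrite !permKV => ->.
have transP (G H K : sgraph V) : isomorphic G H -> isomorphic H K -> isomorphic G K.
  move=> /existsP[s /forallP sP] /existsP[r /forallP rP]; apply/existsP; exists (s * r)%g.
  apply/forallP => x; apply/forallP => y; rewrite !permM.
  have /forallP/(_ y)/eqP -> := sP x.
  by have /forallP/(_ (s y))/eqP -> := rP (s x).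
move=> G H K; split.
  by apply/existsP; exists 1%g; apply/forallP => x; apply/forallP => y; rewrite !perm1.
by move=> GH; apply/idP/idP; apply: transP => //; apply: symP.
Qed.

(** For the identity coloring a color-preserving permutation fixes every vertex, so graphs with the
    same code are equal. *)
Lemma encodes_labeled_3LP n : 2 < n ->
  encodes (labeled_3LP n) (@good_code 'I_n 'I_n id).
Proof.
move=> n3; have V3 : 2 < #|'I_n| by rewrite card_ord.
pose P (G : labeled_3LP n) c := has_code id (val G) c.
have codeP G : exists c, P G c by apply: is_3LP_code V3 (valP G).
have [h hP] := choice codeP.
exists h => [G H hGH|c].
  apply: val_inj; apply: sgraph_eqP => x y.
  have := hP H; rewrite -hGH => /(has_code_inj (hP G))[s ks ->].
  by rewrite !ks.
split=> [/(good_code_realized V3)[G G3 Gc]|[G <-]]; last exact: has_code_good (hP G).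
by exists (exist _ G G3); apply: has_code_fun Gc; apply: (hP (exist _ G G3)).
Qed.

(** With one color [color_iso] is isomorphism. The code of any member is then the code of its whole
    isomorphism class, and distinct classes have distinct codes. *)
Lemma encodes_unlabeled_3LP n : 2 < n ->
  encodes (unlabeled_3LP n) (@good_code 'I_n unit (fun=> tt)).
Proof.
move=> n3; have V3 : 2 < #|'I_n| by rewrite card_ord.
pose D := [set G : sgraph 'I_n | is_3LP G].
pose k (_ : 'I_n) := tt.
have isoP (G H : sgraph 'I_n) : color_iso k G H <-> isomorphic G H.
  split=> [[s _ sP]|/existsP[s /forallP sP]].
    by apply/existsP; exists s; apply/forallP => x; apply/forallP => y; apply/eqP.
  by exists s => // x y; have /forallP/(_ y)/eqP := sP x.
have eqv : {in D & &, equivalence_rel (@isomorphic 'I_n)}.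
  by move=> G H K _ _ _; apply: isomorphic_equiv.
have part := equivalence_partitionP eqv; have /and3P[/eqP cov tr n0] := part.
pose P (I : unlabeled_3LP n) c := exists2 G, G \in val I & has_code k G c.
have inD (I : unlabeled_3LP n) G : G \in val I -> G \in D.
  by move=> GI; rewrite -cov; apply/bigcupP; exists (val I) => //; apply: valP.
have same (I : unlabeled_3LP n) G H : G \in val I -> (H \in val I) = (H \in D) && isomorphic G H.
  move=> GI; have HI : pblock (equivalence_partition (@isomorphic 'I_n) D) G = val I.
    by apply: def_pblock GI => //; apply: valP.
  have GD := inD _ _ GI; apply/idP/andP => [HI'|[HD GH]].
    split; first exact: inD HI'.
    by rewrite -(pblock_equivalence_partition eqv) ?HI // (inD _ _ HI').
  by rewrite -HI (pblock_equivalence_partition eqv).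
have codeP I : exists c, P I c.
  have IP : val I \in equivalence_partition (@isomorphic 'I_n) D := valP I.
  have [I0|[G GI]] := set_0Vmem (val I); first by rewrite I0 (negPf n0) in IP.
  have := inD _ _ GI; rewrite inE => /(is_3LP_code k V3)[c Gc].
  by exists c, G.
have [h hP] := choice codeP.
exists h => [I J hIJ|c].
  have [G GI Gc] := hP I; have [H HJ Hc] := hP J.
  rewrite hIJ in Gc; have GH : isomorphic G H by apply/isoP/(has_code_inj Gc Hc).
  apply: val_inj; apply/setP => K; rewrite (same I G) // (same J H) //; congr (_ && _).
  by have [_ /(_ GH)] := @isomorphic_equiv 'I_n G H K.
split=> [/(good_code_realized V3)[G G3 Gc]|[I <-]]; last first.
  by have [G _] := hP I; apply: has_code_good.
have GD : G \in D by rewrite inE.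
have BP : pblock (equivalence_partition (@isomorphic 'I_n) D) G
    \in equivalence_partition (@isomorphic 'I_n) D by rewrite pblock_mem // cov.
pose I : unlabeled_3LP n 
  := exist (fun B => B \in equivalence_partition (@isomorphic 'I_n) D) _ BP.
have GI : G \in val I by rewrite /= mem_pblock cov.
exists I; have [H HI Hc] := hP I.
have GH : isomorphic G H by move: HI; rewrite (same I G) // => /andP[].
by apply: has_code_fun Hc _; apply: has_code_iso Gc; apply/isoP.
Qed.

Lemma encodes_class_3LP (s : setting) n : 2 < n ->
  exists (W : finType) (k : 'I_n -> W), adm s (wset k setT) /\
    encodes (class_3LP s n) (@good_code 'I_n W k).
Proof.
move=> n3; case: s.
  exists 'I_n, id; split; last exact: encodes_labeled_3LP.
  move=> i; rewrite wsetE (_ : [set _ in _ | _] = [set i]) ?cards1 //.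
  by apply/setP => j; rewrite !inE.
exists unit, (fun=> tt); split; first exact: card_unit.
exact: encodes_unlabeled_3LP.
Qed.

(** Good codes are of two kinds: the one-node code, which is the complete graph and matches the
    single object of [K], and the centered codes with at least two kids at the root, which
    [dissymmetry] counts. *)
Lemma card_class_3LP (s : setting) (X : system_classes) n : solution s X -> 3 <= n ->
  #|class_3LP s n| + #|cT_StoS X n| = #|cK X n| + #|cT_S X n| + #|cT_SS X n|.
Proof.
move=> solX n3; have [W [k [admk enc3]]] := encodes_class_3LP s n3.
pose mu := wset k setT.
have mun : msz mu = n by rewrite msz_wset cardsT card_ord.
have [H encH] := encodes_restrict (@centered W) (encodes_cT_S solX admk).
have := dissymmetry solX admk encH; rewrite -/mu mun => dis.
rewrite (card_cK solX) n3 -addnA dis addnA; congr (_ + _).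
have mu0 : mu != 0%R by rewrite -msz_gt0 mun (leq_trans _ n3).
have enc1 := encodes1 (Node mu [::]) card_unit.
transitivity #|{: unit + H}|; last by rewrite card_sum card_unit.
apply: (encodes_card enc3).
apply: encodes_ext (encodes_sum _ enc1 encH) => [c|c ->]; last by case=> -[].
split=> [[->|[[[vc tc] kc] cc]]|[vc tc kc cc]].
- by split=> //=; rewrite ?mu0 // tot_node big_nil addr0.
- by split=> //; rewrite neq_ltn kc orbT.
case: c vc tc kc cc => m [|d [|d' l]] //= vc tc _ cc; [left | right].
  by move: tc; rewrite tot_node big_nil addr0 => ->.
by split.
Qed.

Theorem theorem2 (s : setting) :
  (exists X : system_classes, solution s X) /\
  (forall X Y : system_classes, solution s X -> solution s Y -> classes_iso X Y) /\
  (forall X : system_classes, solution s X ->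
     forall n : nat, 3 <= n ->
       #|class_3LP s n| + #|cT_StoS X n| =
       #|cK X n| + #|cT_S X n| + #|cT_SS X n|).
Proof.
split; first exact: solution_exists.
split=> [X Y|X solX n n3]; first exact: solution_unique.
exact: card_class_3LP.
Qed.
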